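(* Let $n\ge1$ and let $\mathcal{C}$ be a Krull–Schmidt $(n+2)$-angulated category with $n$-suspension functor $\Sigma^n$. If $\mathcal{C}$ is a dualizing $k$-variety, then $\mathcal{C}$ has Auslander–Reiten $(n+2)$-angles.
   Context: **$(n+2)$-angulated categories (Geiss–Keller–Oppermann).** Let $\mathcal{C}$ be an additive category with an automorphism $\Sigma^n$ (the $n$-suspension functor). An $(n+2)$-angulated structure is a class of sequences $A_0\xrightarrow{\alpha_0}A_1\xrightarrow{\alpha_1}\cdots\xrightarrow{\alpha_n}A_{n+1}\xrightarrow{\alpha_{n+1}}\Sigma^nA_0$, called $(n+2)$-angles, such that: (N1) the class is closed under isomorphisms, direct sums and direct summands, contains $A\xrightarrow{1}A\to0\to\cdots\to0\to\Sigma^nA$ for each object $A$, and every morphism is the first morphism $\alpha_0$ of some $(n+2)$-angle; (N2) a sequence $A_0\xrightarrow{\alpha_0}A_1\xrightarrow{\alpha_1}\cdots\xrightarrow{\alpha_n}A_{n+1}\xrightarrow{\alpha_{n+1}}\Sigma^nA_0$ in $\mathcal{C}$ is an $(n+2)$-angle iff its rotation $A_1\xrightarrow{\alpha_1}\cdots\xrightarrow{\alpha_{n+1}}\Sigma^nA_0\xrightarrow{(-1)^n\Sigma^n\alpha_0}\Sigma^nA_1$ is; (N3) any commutative square between the first morphisms of two $(n+2)$-angles extends to a morphism of $(n+2)$-angles; (N4) in (N3) the extension can be chosen so that its mapping cone is an $(n+2)$-angle. **Dualizing varieties.** $k$ is a commutative Artin ring, $E$ the injective envelope of $k$ (i.e.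 of $k/\mathrm{rad}\,k$), $D=\mathrm{Hom}_k(-,E)$, applied objectwise to functors. For an additive category $\mathcal{A}$, $\mathrm{mod}\,\mathcal{A}$ is the category of finitely presented functors $\mathcal{A}^{op}\to\mathsf{Ab}$. A $k$-linear additive category $\mathcal{C}$ is a dualizing $k$-variety if it is Hom-finite and Krull–Schmidt, $DF\in\mathrm{mod}(\mathcal{C}^{op})$ for all $F\in\mathrm{mod}\,\mathcal{C}$, and $DG\in\mathrm{mod}\,\mathcal{C}$ for all $G\in\mathrm{mod}(\mathcal{C}^{op})$. **Auslander–Reiten $(n+2)$-angles.** An $(n+2)$-angle $A_0\xrightarrow{\alpha_0}A_1\to\cdots\xrightarrow{\alpha_n}A_{n+1}\xrightarrow{\alpha_{n+1}}\Sigma^nA_0$ is an Auslander–Reiten $(n+2)$-angle if $\alpha_0$ is left almost split, $\alpha_n$ is right almost split, and, when $n\ge2$, $\alpha_1,\dots,\alpha_{n-1}$ lie in the radical of $\mathcal{C}$. ($\alpha_0\colon A_0\to A_1$ is left almost split if it is not a split monomorphism and every morphism $A_0\to B$ that is not a split monomorphism factors through $\alpha_0$; right almost split is dual.) $\mathcal{C}$ has Auslander–Reiten $(n+2)$-angles if for each indecomposable object $X$ there is an Auslander–Reiten $(n+2)$-angle with $A_{n+1}=X$ and one with $A_0=X$. *)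

(* Defs.v *)
From HB Require Import structures.
From mathcomp Require Import all_boot all_order all_algebra.
From mathcomp Require Import boolp.

Set Implicit Arguments.
Unset Strict Implicit.
Unset Printing Implicit Defensive.

Import GRing.Theory.

Local Open Scope ring_scope.

Declare Scope cat_scope.
Delimit Scope cat_scope with C.
Local Open Scope cat_scope.

#[local] Obligation Tactic := idtac.

(** * Modules over a commutative ring *)

Section Modules.
Variable k : comPzRingType.

Definition submodule (M : lmodType k) (S : M -> Prop) : Prop :=
  [/\ S 0, forall x y, S x -> S y -> S (x + y) & forall a x, S x -> S (a *: x)].

Definition ideal (I : k -> Prop) : Prop := @submodule k^o I.

Definition artinian : Prop :=
  forall I : nat -> k -> Prop,
    (forall i, ideal (I i)) ->
    (forall i x, I i.+1 x -> I i x) ->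
    exists m, forall i, (m <= i)%N -> forall x, I m x -> I i x.

Definition maximal_ideal (I : k -> Prop) : Prop :=
  [/\ ideal I, ~ I 1 &
      forall J, ideal J -> ~ J 1 -> (forall x, I x -> J x) ->
        forall x, J x -> I x].

Definition jacobson (x : k) : Prop := forall I, maximal_ideal I -> I x.

Definition finitely_generated (M : lmodType k) : Prop :=
  exists m (v : 'I_m -> M), forall x, exists c : 'I_m -> k,
    x = \sum_(i < m) c i *: v i.

Definition injective_module (E : lmodType k) : Prop :=
  forall (M N : lmodType k) (i : {linear M -> N}) (f : {linear M -> E}),
    injective i -> exists g : {linear N -> E}, forall x, g (i x) = f x.

Definition injective_envelope (M E : lmodType k) (j : {linear M -> E}) : Prop :=
  [/\ injective_module E,
      injective j &
      forall S : E -> Prop, submodule S -> (exists2 x, S x & x <> 0) ->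
        exists2 y, S (j y) & j y <> 0].

(** [Q], equipped with [p], is the quotient module k/rad k. *)
Definition is_top_quotient (Q : lmodType k) (p : {linear k^o -> Q}) : Prop :=
  (forall q, exists x, p x = q) /\ (forall x : k, p x = 0 <-> jacobson x).

Definition injective_envelope_of_top (E : lmodType k) : Prop :=
  exists (Q : lmodType k) (p : {linear k^o -> Q}) (j : {linear Q -> E}),
    is_top_quotient p /\ injective_envelope j.

(** The k-module of linear maps; the library has no such instance on
    [{linear M -> N}]. *)
Definition linhom (M N : lmodType k) : Type := {linear M -> N}.

Section LinHom.
Variables M N : lmodType k.
Implicit Types f g h : linhom M N.

Definition linhom_fun f : M -> N := (f : {linear M -> N}).

HB.instance Definition _ := gen_eqMixin (linhom M N).
HB.instance Definition _ := gen_choiceMixin (linhom M N).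

Lemma linhomP f g : linhom_fun f =1 linhom_fun g -> f = g.
Proof.
move=> /funext; case: f g => f [[fD] [fZ]] [g [[gD] [gZ]]].
rewrite /linhom_fun /= => fg; case: _ / fg in gD gZ *.
by rewrite (Prop_irrelevance fD gD) (Prop_irrelevance fZ gZ).
Qed.

Definition linhom_zero : linhom M N := (\0 : M -> N).
Definition linhom_opp f : linhom M N := (\- (f : {linear M -> N})).
Definition linhom_add f g : linhom M N :=
  ((f : {linear M -> N}) \+ (g : {linear M -> N})).
Definition linhom_scale (a : k) f : linhom M N :=
  (a \*: (f : {linear M -> N})).

Fact linhom_addA : associative linhom_add.
Proof. by move=> f g h; apply: linhomP => x; apply: addrA. Qed.
Fact linhom_addC : commutative linhom_add.
Proof. by move=> f g; apply: linhomP => x; apply: addrC. Qed.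
Fact linhom_add0 : left_id linhom_zero linhom_add.
Proof. by move=> f; apply: linhomP => x; apply: add0r. Qed.
Fact linhom_addN : left_inverse linhom_zero linhom_opp linhom_add.
Proof. by move=> f; apply: linhomP => x; apply: addNr. Qed.

HB.instance Definition _ := GRing.isZmodule.Build (linhom M N)
  linhom_addA linhom_addC linhom_add0 linhom_addN.

Fact linhom_scaleA a b f :
  linhom_scale a (linhom_scale b f) = linhom_scale (a * b) f.
Proof. by apply: linhomP => x; apply: scalerA. Qed.
Fact linhom_scale1 : left_id 1 linhom_scale.
Proof. by move=> f; apply: linhomP => x; apply: scale1r. Qed.
Fact linhom_scaleDr : right_distributive linhom_scale +%R.
Proof. by move=> a f g; apply: linhomP => x; apply: scalerDr. Qed.
Fact linhom_scaleDl f : {morph linhom_scale^~ f : a b / a + b}.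
Proof. by move=> a b; apply: linhomP => x; apply: scalerDl. Qed.

HB.instance Definition _ := GRing.Zmodule_isLmodule.Build k (linhom M N)
  linhom_scaleA linhom_scale1 linhom_scaleDr linhom_scaleDl.

End LinHom.
End Modules.

(** * k-linear additive categories *)

Record addCat (k : comPzRingType) := AddCat {
  obj :> Type;
  arr : obj -> obj -> lmodType k;
  idm : forall A, arr A A;
  compm : forall A B D, arr B D -> arr A B -> arr A D;
  compmA : forall A B D F (h : arr D F) (g : arr B D) (f : arr A B),
    compm h (compm g f) = compm (compm h g) f;
  comp1m : forall A B (f : arr A B), compm (idm B) f = f;
  compm1 : forall A B (f : arr A B), compm f (idm A) = f;
  comp_linearl : forall A B D (f : arr A B),
    linear (fun g : arr B D => compm g f);
  comp_linearr : forall A B D (g : arr B D),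
    linear (fun f : arr A B => compm g f);
  zero_ob : obj;
  zero_obP : idm zero_ob = 0;
  biprod : obj -> obj -> obj;
  inj1 : forall A B, arr A (biprod A B);
  inj2 : forall A B, arr B (biprod A B);
  prj1 : forall A B, arr (biprod A B) A;
  prj2 : forall A B, arr (biprod A B) B;
  prj1_inj1 : forall A B, compm (prj1 A B) (inj1 A B) = idm A;
  prj2_inj2 : forall A B, compm (prj2 A B) (inj2 A B) = idm B;
  prj1_inj2 : forall A B, compm (prj1 A B) (inj2 A B) = 0;
  prj2_inj1 : forall A B, compm (prj2 A B) (inj1 A B) = 0;
  biprod_id : forall A B,
    compm (inj1 A B) (prj1 A B) + compm (inj2 A B) (prj2 A B)
      = idm (biprod A B)
}.

Arguments arr {k C} A B : rename.
Arguments idm {k C} A : rename.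
Arguments compm {k C A B D} g f : rename.
Arguments zero_ob {k C} : rename.
Arguments biprod {k C} A B : rename.
Arguments inj1 {k C} A B : rename.
Arguments inj2 {k C} A B : rename.
Arguments prj1 {k C} A B : rename.
Arguments prj2 {k C} A B : rename.

Notation "g ∘ f" := (compm g f) (at level 40, left associativity) : cat_scope.
Notation "A ⊕ B" := (biprod A B) (at level 50, left associativity) : cat_scope.

Section Categories.
Variables (k : comPzRingType) (C : addCat k).
Implicit Types A B X Y Z : C.

Definition is_iso A B (f : arr A B) : Prop :=
  exists g : arr B A, g ∘ f = idm A /\ f ∘ g = idm B.
Definition isomorphic A B : Prop := exists f : arr A B, is_iso f.

Definition split_mono A B (f : arr A B) : Prop :=
  exists r : arr B A, r ∘ f = idm A.
Definition split_epi A B (f : arr A B) : Prop :=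
  exists s : arr B A, f ∘ s = idm B.

Definition is_zero A : Prop := idm A = 0.

Definition indecomposable X : Prop :=
  ~ is_zero X /\
  forall A B, isomorphic X (A ⊕ B) -> is_zero A \/ is_zero B.

(** End(X) is a local ring: it is nonzero and its non-units are closed under
    addition. *)
Definition local_endo X : Prop :=
  idm X <> 0 /\
  forall f g : arr X X, ~ is_iso f -> ~ is_iso g -> ~ is_iso (f + g).

Definition krull_schmidt : Prop :=
  forall X, exists m (Y : 'I_m -> C),
    (forall i, local_endo (Y i)) /\
    isomorphic X (\big[biprod/zero_ob]_(i < m) Y i).

Definition hom_finite : Prop := forall A B, finitely_generated (arr A B).

(** The Jacobson radical of the category. *)
Definition in_radical A B (f : arr A B) : Prop :=
  forall g : arr B A, is_iso (idm A - g ∘ f).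

Definition left_almost_split A0 A1 (f : arr A0 A1) : Prop :=
  ~ split_mono f /\
  forall B (u : arr A0 B), ~ split_mono u -> exists v : arr A1 B, u = v ∘ f.

Definition right_almost_split A B (f : arr A B) : Prop :=
  ~ split_epi f /\
  forall X (u : arr X B), ~ split_epi u -> exists v : arr X A, u = f ∘ v.

(** The morphism given by the matrix ((a, b), (c, d)). *)
Definition mx2 A B A' B' (a : arr A A') (b : arr B A')
    (c : arr A B') (d : arr B B') : arr (A ⊕ B) (A' ⊕ B') :=
  inj1 A' B' ∘ (a ∘ prj1 A B + b ∘ prj2 A B)
  + inj2 A' B' ∘ (c ∘ prj1 A B + d ∘ prj2 A B).

(** * Functors to k-modules *)

(** k-linear functors C^op -> Mod k.  An additive functor C^op -> Ab on a
    k-linear category is the same thing, a scalar [a] acting on [F X] as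
    [F (a *: idm X)]. *)
Record contrafun := ContraFun {
  cn_ob :> C -> lmodType k;
  cn_map : forall A B, arr A B -> {linear cn_ob B -> cn_ob A};
  cn_map1 : forall A x, cn_map (idm A) x = x;
  cn_mapM : forall A B D (g : arr B D) (f : arr A B) x,
    cn_map (g ∘ f) x = cn_map f (cn_map g x);
  cn_map_linear : forall A B x, linear (fun f : arr A B => cn_map f x)
}.

(** k-linear functors (C^op)^op = C -> Mod k. *)
Record cofun := CoFun {
  co_ob :> C -> lmodType k;
  co_map : forall A B, arr A B -> {linear co_ob A -> co_ob B};
  co_map1 : forall A x, co_map (idm A) x = x;
  co_mapM : forall A B D (g : arr B D) (f : arr A B) x,
    co_map (g ∘ f) x = co_map g (co_map f x);
  co_map_linear : forall A B x, linear (fun f : arr A B => co_map f x)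
}.

Record contranat (F G : contrafun) := ContraNat {
  cn_app :> forall X, {linear F X -> G X};
  cn_natural : forall X Y (f : arr X Y) (y : F Y),
    cn_app X (cn_map F f y) = cn_map G f (cn_app Y y)
}.

Record conat (F G : cofun) := CoNat {
  co_app :> forall X, {linear F X -> G X};
  co_natural : forall X Y (f : arr X Y) (x : F X),
    co_app Y (co_map F f x) = co_map G f (co_app X x)
}.

Definition precomp A X Y (f : arr X Y) (g : arr Y A) : arr X A := g ∘ f.
Definition postcomp A X Y (f : arr X Y) (g : arr A X) : arr A Y := f ∘ g.

HB.instance Definition _ A X Y (f : arr X Y) :=
  GRing.isLinear.Build k (arr Y A) (arr X A) *:%R (@precomp A X Y f)
    (comp_linearl f).
HB.instance Definition _ A X Y (f : arr X Y) :=
  GRing.isLinear.Build k (arr A X) (arr A Y) *:%R (@postcomp A X Y f)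
    (comp_linearr f).

Program Definition hom_to A : contrafun :=
  @ContraFun (fun X => arr X A)
    (fun X Y (f : arr X Y) => @precomp A X Y f : {linear _ -> _}) _ _ _.
Next Obligation. by move=> A X x; apply: compm1. Qed.
Next Obligation. by move=> A X Y D g f x; apply: compmA. Qed.
Next Obligation. by move=> A X Y x; apply: comp_linearr. Qed.

Program Definition hom_from A : cofun :=
  @CoFun (fun X => arr A X)
    (fun X Y (f : arr X Y) => @postcomp A X Y f : {linear _ -> _}) _ _ _.
Next Obligation. by move=> A X x; apply: comp1m. Qed.
Next Obligation. by move=> A X Y D g f x; rewrite /= /postcomp compmA. Qed.
Next Obligation. by move=> A X Y x; apply: comp_linearl. Qed.

(** F is in mod C: C(-,A) -> C(-,B) -> F -> 0 is exact. *)
Definition fp_contra (F : contrafun) : Prop :=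
  exists A B (u : contranat (hom_to A) (hom_to B)) (v : contranat (hom_to B) F),
    forall X, (forall z, exists y, v X y = z) /\
              (forall y, v X y = 0 <-> exists x, u X x = y).

(** F is in mod (C^op). *)
Definition fp_co (F : cofun) : Prop :=
  exists A B (u : conat (hom_from A) (hom_from B)) (v : conat (hom_from B) F),
    forall X, (forall z, exists y, v X y = z) /\
              (forall y, v X y = 0 <-> exists x, u X x = y).

Section Dual.
Variable E : lmodType k.

Definition dual_map (M N : lmodType k) (f : {linear M -> N})
    (phi : linhom N E) : linhom M E :=
  (phi : {linear N -> E}) \o f.

Fact dual_map_linear (M N : lmodType k) (f : {linear M -> N}) :
  linear (dual_map f).
Proof. by move=> a phi psi; apply: linhomP. Qed.

HB.instance Definition _ (M N : lmodType k) (f : {linear M -> N}) :=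
  GRing.isLinear.Build k (linhom N E) (linhom M E) *:%R (dual_map f)
    (dual_map_linear f).

Program Definition dual_contra (F : contrafun) : cofun :=
  @CoFun (fun X => linhom (F X) E)
    (fun X Y (f : arr X Y) => dual_map (cn_map F f) : {linear _ -> _}) _ _ _.
Next Obligation.
by move=> F X phi; apply: linhomP => x; rewrite /linhom_fun /= cn_map1.
Qed.
Next Obligation.
move=> F X Y Z g f phi; apply: linhomP => x.
by rewrite /linhom_fun /= cn_mapM.
Qed.
Next Obligation.
move=> F X Y phi a f g; apply: linhomP => x /=.
by rewrite /linhom_fun /= cn_map_linear linearP.
Qed.

Program Definition dual_co (G : cofun) : contrafun :=
  @ContraFun (fun X => linhom (G X) E)
    (fun X Y (f : arr X Y) => dual_map (co_map G f) : {linear _ -> _}) _ _ _.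
Next Obligation.
by move=> F X phi; apply: linhomP => x; rewrite /linhom_fun /= co_map1.
Qed.
Next Obligation.
move=> F X Y Z g f phi; apply: linhomP => x.
by rewrite /linhom_fun /= co_mapM.
Qed.
Next Obligation.
move=> F X Y phi a f g; apply: linhomP => x /=.
by rewrite /linhom_fun /= co_map_linear linearP.
Qed.

Definition dualizing_variety : Prop :=
  [/\ hom_finite,
      krull_schmidt,
      forall F : contrafun, fp_contra F -> fp_co (dual_contra F) &
      forall G : cofun, fp_co G -> fp_contra (dual_co G)].

End Dual.

(** * Chains of composable morphisms *)

(** [chain m A Z] is the type of chains A -> X_1 -> ... -> X_m -> Z of [m.+1]
    composable morphisms; the recursion keeps both ends as indices, so that
    rotating a sequence needs no transport along equalities of objects. *)
Fixpoint chain (m : nat) (A Z : C) : Type :=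
  if m is m'.+1 then {B : C & (arr A B * chain m' B Z)%type} else arr A Z.

Fixpoint chain_rcons m : forall A Y Z,
    chain m A Y -> arr Y Z -> chain m.+1 A Z :=
  match m with
  | 0 => fun A Y Z (f : arr A Y) g => existT _ Y (f, g)
  | m'.+1 => fun A Y Z p g =>
      existT _ (projT1 p) ((projT2 p).1, chain_rcons (projT2 p).2 g)
  end.

(** The [i]-th object (A for i = 0, X_i for 1 <= i <= m); junk value Z past
    the end. *)
Fixpoint chain_ob (i : nat) : forall m A Z, chain m A Z -> C :=
  match i with
  | 0 => fun m A Z _ => A
  | i'.+1 => fun m =>
      match m with
      | 0 => fun A Z _ => Z
      | m'.+1 => fun A Z p => chain_ob i' (projT2 p).2
      end
  end.

(** Meaningful for i <= m, but when i = m its codomain is only propositionally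
    Z; [chain_last] is the final morphism with its proper codomain. *)
Fixpoint chain_arr (i : nat) : forall m A Z (p : chain m A Z),
    arr (chain_ob i p) (chain_ob i.+1 p) :=
  match i with
  | 0 => fun m =>
      match m with
      | 0 => fun A Z p => p
      | m'.+1 => fun A Z p => (projT2 p).1
      end
  | i'.+1 => fun m =>
      match m with
      | 0 => fun A Z p => idm Z
      | m'.+1 => fun A Z p => chain_arr i' (projT2 p).2
      end
  end.

Fixpoint chain_last m : forall A Z (p : chain m A Z), arr (chain_ob m p) Z :=
  match m with
  | 0 => fun A Z p => p
  | m'.+1 => fun A Z p => chain_last (projT2 p).2
  end.

(** The chain W_0 -> W_1 -> ... -> W_m -> Z with the given morphisms. *)
Fixpoint mkchain m : forall (W : nat -> C) (a : forall i, arr (W i) (W i.+1)) Z,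
    arr (W m) Z -> chain m (W 0%N) Z :=
  match m with
  | 0 => fun W a Z l => l
  | m'.+1 => fun W a Z l =>
      existT _ (W 1%N)
        (a 0%N, mkchain (W := fun i => W i.+1) (fun i => a i.+1) l)
  end.

End Categories.

(** * (n+2)-angulated categories *)

(** An automorphism of an additive category: an additive functor bijective on
    objects and on morphisms. *)
Record automorphism (k : comPzRingType) (C : addCat k) := Automorphism {
  sus :> C -> C;
  smap : forall A B, arr A B -> arr (sus A) (sus B);
  smap1 : forall A, smap (idm A) = idm (sus A);
  smapM : forall A B D (g : arr B D) (f : arr A B),
    smap (g ∘ f) = smap g ∘ smap f;
  smapD : forall A B (f g : arr A B), smap (f + g) = smap f + smap g;
  sus_bij : bijective sus;
  smap_bij : forall A B, bijective (@smap A B)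
}.

Section Angles.
Variables (k : comPzRingType) (C : addCat k) (S : automorphism C) (n : nat).

(** Sequences A_0 -> A_1 -> ... -> A_{n+1} -> S A_0. *)
Definition sigma_seq : Type := {A0 : C & chain n.+1 A0 (S A0)}.

Implicit Types s t : sigma_seq.

(** [sob s i] is A_i for i <= n.+1; [sarr s i] is alpha_i for i <= n; [slast s]
    is alpha_{n+1}. *)
Definition sob s (i : nat) : C := chain_ob i (projT2 s).
Definition sarr s (i : nat) : arr (sob s i) (sob s i.+1) :=
  chain_arr i (projT2 s).
Definition slast s : arr (sob s n.+1) (S (sob s 0%N)) := chain_last (projT2 s).

Definition mk_sigma_seq (W : nat -> C) (a : forall i, arr (W i) (W i.+1))
    (l : arr (W n.+1) (S (W 0%N))) : sigma_seq :=
  existT _ (W 0%N) (mkchain a l).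

Definition rotate s : sigma_seq :=
  let: existT _ (existT A1 (a0, p)) := s in
  existT _ A1 (chain_rcons p ((-1) ^+ n *: smap S a0)).

Definition trivial_seq (A : C) : sigma_seq :=
  @mk_sigma_seq (fun i => if i is i'.+2 then zero_ob else A)
    (fun i => if i is i'.+1 then 0 else idm A) 0.

Definition dsum_seq s t : sigma_seq :=
  @mk_sigma_seq (fun i => sob s i ⊕ sob t i)
    (fun i => mx2 (sarr s i) 0 0 (sarr t i))
    (smap S (inj1 _ _) ∘ (slast s ∘ prj1 _ _)
     + smap S (inj2 _ _) ∘ (slast t ∘ prj2 _ _)).

(** Components past n.+1 are irrelevant. *)
Record seq_mor s t := SeqMor {
  mcomp :> forall i, arr (sob s i) (sob t i);
  mcomp_arr : forall i, (i <= n)%N ->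
    mcomp i.+1 ∘ sarr s i = sarr t i ∘ mcomp i;
  mcomp_last : smap S (mcomp 0%N) ∘ slast s = slast t ∘ mcomp n.+1
}.

Definition seq_isomorphic s t : Prop :=
  exists phi : seq_mor s t, forall i, (i <= n.+1)%N -> is_iso (phi i).

(** The mapping cone
      A_1 ⊕ B_0 -> A_2 ⊕ B_1 -> ... -> A_{n+1} ⊕ B_n
        -> S A_0 ⊕ B_{n+1} -> S (A_1 ⊕ B_0) = S A_1 ⊕ S B_0
    with morphisms ((- alpha_{i+1}, 0), (phi_{i+1}, beta_i)) for i <= n and
    ((- S alpha_0, 0), (S phi_0, beta_{n+1})). *)
Definition cone s t (phi : seq_mor s t) : sigma_seq :=
  existT (fun X => chain n.+1 X (S X)) (sob s 1 ⊕ sob t 0)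
    (chain_rcons
      (mkchain (W := fun i => sob s i.+1 ⊕ sob t i)
        (fun i => mx2 (- sarr s i.+1) 0 (phi i.+1) (sarr t i))
        (mx2 (- slast s) 0 (phi n.+1) (sarr t n)))
      (smap S (inj1 _ _) ∘ (- smap S (sarr s 0) ∘ prj1 _ _)
       + smap S (inj2 _ _)
           ∘ (smap S (phi 0%N) ∘ prj1 _ _ + slast t ∘ prj2 _ _))).

End Angles.

Record angulated (k : comPzRingType) (C : addCat k) (n : nat) := Angulated {
  susp : automorphism C;
  angle : sigma_seq susp n -> Prop;
  angle_iso : forall s t, seq_isomorphic s t -> angle s -> angle t;
  angle_dsum : forall s t, angle s -> angle t -> angle (dsum_seq s t);
  angle_summand : forall s t, angle (dsum_seq s t) -> angle s /\ angle t;
  angle_trivial : forall A, angle (trivial_seq susp n A);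
  angle_first : forall A0 A1 (f : arr A0 A1),
    exists p : chain n A1 (susp A0),
      angle (existT (fun X => chain n.+1 X (susp X)) A0 (existT _ A1 (f, p)));
  angle_rotate : forall s, angle s <-> angle (rotate s);
  angle_mor : forall s t (f0 : arr (sob s 0) (sob t 0))
      (f1 : arr (sob s 1) (sob t 1)),
    angle s -> angle t -> f1 ∘ sarr s 0 = sarr t 0 ∘ f0 ->
    exists phi : seq_mor s t, phi 0%N = f0 /\ phi 1%N = f1;
  angle_cone : forall s t (f0 : arr (sob s 0) (sob t 0))
      (f1 : arr (sob s 1) (sob t 1)),
    angle s -> angle t -> f1 ∘ sarr s 0 = sarr t 0 ∘ f0 ->
    exists phi : seq_mor s t,
      [/\ phi 0%N = f0, phi 1%N = f1 & angle (cone phi)]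
}.

Section AuslanderReiten.
Variables (k : comPzRingType) (C : addCat k) (n : nat) (T : angulated C n).

Definition AR_angle (s : sigma_seq (susp T) n) : Prop :=
  [/\ angle s,
      left_almost_split (sarr s 0),
      right_almost_split (sarr s n) &
      forall i, (0 < i < n)%N -> in_radical (sarr s i)].

Definition has_AR_angles : Prop :=
  forall X : C, indecomposable X ->
    (exists2 s, AR_angle s & sob s n.+1 = X) /\
    (exists2 s, AR_angle s & sob s 0 = X).

End AuslanderReiten.

(* Main.v *)
Require Import Defs.
From HB Require Import structures.
From mathcomp Require Import all_boot all_order all_algebra.
From mathcomp Require Import boolp.

(** Write S for the suspension.  In an angle whose last morphism is
    [d : X -> S A], the morphism before [d] is a weak kernel of [d] and the
    suspension of the first one is a weak cokernel of [d] ([angle_exact_last],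
    [angle_exact_around]).  Hence the two almost split conditions depend on [d]
    alone: [d f = 0] must hold exactly for the [f] that are not split
    epimorphisms, and [g d = 0] exactly for the [g] that are not split
    monomorphisms ([almost_split_connecting]).

    To find such a [d] out of [X], note that [End X] is local.  As E is an
    injective envelope of k/rad k, there is a functional on [End X] vanishing on
    the non-units but not at 1 ([local_endo_functional]).  It defines a morphism
    C(-,X) -> DC(X,-) whose kernel is the radical, and DC(X,-) is finitely
    presented because C is a dualizing variety.  Weak kernels therefore yield a
    right almost split morphism into [X].  A nonzero component, with local target,
    of a weak cokernel of it satisfies both conditions
    ([almost_split_connecting_exists]).  The same construction in the opposite
    category gives a [d] with target S X when the angle must start at [X].

    Finally [d] is completed to an angle.  An inner morphism outside the radical
    has an invertible component between local summands, so a trivial summand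
    Y = Y splits off ([chain_reduce]); the remaining summand is again an angle with
    the same [d], and it has fewer local summands.  This ends with all inner
    morphisms in the radical ([angle_minimal]). *)

Set Implicit Arguments.
Unset Strict Implicit.
Unset Printing Implicit Defensive.

Import GRing.Theory.

Local Open Scope ring_scope.
Local Open Scope cat_scope.

#[local] Obligation Tactic := idtac.

(** * Composition in a k-linear category *)

Section Basics.
Variables (k : comPzRingType) (C : addCat k).
Implicit Types A B D X Y Z W : C.

Lemma compDl A B D (g g' : arr B D) (f : arr A B) :
  (g + g') ∘ f = g ∘ f + g' ∘ f.
Proof. by have := comp_linearl f 1 g g'; rewrite !scale1r. Qed.

Lemma compDr A B D (g : arr B D) (f f' : arr A B) :
  g ∘ (f + f') = g ∘ f + g ∘ f'.
Proof. by have := comp_linearr g 1 f f'; rewrite !scale1r. Qed.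

Lemma comp0m A B D (f : arr A B) : (0 : arr B D) ∘ f = 0.
Proof. by apply: (addrI ((0 : arr B D) ∘ f)); rewrite -compDl !addr0. Qed.

Lemma compm0 A B D (g : arr B D) : g ∘ (0 : arr A B) = 0.
Proof. by apply: (addrI (g ∘ (0 : arr A B))); rewrite -compDr !addr0. Qed.

Lemma compZl A B D a (g : arr B D) (f : arr A B) : (a *: g) ∘ f = a *: (g ∘ f).
Proof. by have := comp_linearl f a g 0; rewrite comp0m !addr0. Qed.

Lemma compZr A B D a (g : arr B D) (f : arr A B) : g ∘ (a *: f) = a *: (g ∘ f).
Proof. by have := comp_linearr g a f 0; rewrite compm0 !addr0. Qed.

Lemma compNl A B D (g : arr B D) (f : arr A B) : (- g) ∘ f = - (g ∘ f).
Proof. by rewrite -!scaleN1r compZl. Qed.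

Lemma compNr A B D (g : arr B D) (f : arr A B) : g ∘ (- f) = - (g ∘ f).
Proof. by rewrite -!scaleN1r compZr. Qed.

Lemma compBl A B D (g g' : arr B D) (f : arr A B) :
  (g - g') ∘ f = g ∘ f - g' ∘ f.
Proof. by rewrite compDl compNl. Qed.

Lemma compBr A B D (g : arr B D) (f f' : arr A B) :
  g ∘ (f - f') = g ∘ f - g ∘ f'.
Proof. by rewrite compDr compNr. Qed.

Definition comp_simp := (compDl, compDr, compNl, compNr, comp0m, compm0,
  @comp1m k C, @compm1 k C).

Lemma to_zero_eq A Z (f g : arr A Z) : is_zero Z -> f = g.
Proof. by move=> z; rewrite -[f]comp1m -[g]comp1m z !comp0m. Qed.

Lemma is_iso_id A : is_iso (idm A).
Proof. by exists (idm A); rewrite comp1m. Qed.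

Lemma is_iso_comp A B D (g : arr B D) (f : arr A B) :
  is_iso g -> is_iso f -> is_iso (g ∘ f).
Proof.
move=> [g' [g'g gg']] [f' [f'f ff']]; exists (f' ∘ g'); split.
  by rewrite !compmA -(compmA f') g'g compm1.
by rewrite !compmA -(compmA g) ff' compm1.
Qed.

Lemma is_iso_zero A B (f : arr A B) : is_zero A -> is_zero B -> is_iso f.
Proof.
by move=> zA zB; exists 0; split; [apply: to_zero_eq | apply: to_zero_eq].
Qed.

(** * The radical *)

(** The inverse of [1 - h g] is [1 + h c g], where [c] inverts [1 - g h]. *)
Lemma iso_subC A B (g : arr A B) (h : arr B A) :
  is_iso (idm B - g ∘ h) -> is_iso (idm A - h ∘ g).
Proof.
move=> [c [cl cr]]; exists (idm A + h ∘ c ∘ g).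
move: cl cr; rewrite compBl compBr comp1m compm1 => cl cr.
have el : h ∘ c ∘ g - h ∘ c ∘ g ∘ (h ∘ g) = h ∘ g.
  by rewrite -[in RHS](compm1 h) -cl compBr compBl !compmA.
have er : h ∘ c ∘ g - h ∘ g ∘ (h ∘ c ∘ g) = h ∘ g.
  by rewrite -[in RHS](compm1 h) -cr compBr compBl !compmA.
have cancel (x y z : arr A A) : x - z = y -> idm A + x - (y + z) = idm A.
  by move=> <-; rewrite subrK addrK.
split.
  by rewrite compBr compm1 compDl comp1m cancel.
by rewrite compBl comp1m compDr compm1 cancel.
Qed.

Lemma in_radical_compl A B D (g : arr B D) (f : arr A B) :
  in_radical f -> in_radical (g ∘ f).
Proof. by move=> rf h; rewrite compmA; apply: rf. Qed.

Lemma in_radical_compr A B D (g : arr B D) (f : arr A B) :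
  in_radical g -> in_radical (g ∘ f).
Proof.
move=> rg h; rewrite compmA; apply: iso_subC; rewrite compmA; exact: rg.
Qed.

(** With [u = 1 - h f] invertible, [1 - h (f + g) = u (1 - u^-1 h g)]. *)
Lemma in_radicalD A B (f g : arr A B) :
  in_radical f -> in_radical g -> in_radical (f + g).
Proof.
move=> rf rg h; have uf := rf h; have [c [cl cr]] := uf.
have -> : idm A - h ∘ (f + g) = (idm A - h ∘ f) ∘ (idm A - c ∘ h ∘ g).
  rewrite (compBr (idm A - _)) compm1 !compmA cr comp1m compDr opprD addrA.
  by [].
by apply: is_iso_comp => //; apply: rg.
Qed.

Lemma in_radical0 A B : in_radical (0 : arr A B).
Proof. by move=> h; rewrite compm0 subr0; apply: is_iso_id. Qed.

(** * Objects with local endomorphism ring *)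

Lemma local_endo_neq0 X : local_endo X -> ~ is_zero X.
Proof. by case. Qed.

Lemma local_endo_unit X (e : arr X X) :
  local_endo X -> ~ is_iso (idm X - e) -> is_iso e.
Proof.
move=> [_ loc] ne; apply: contrapT => nf.
by have := loc _ _ nf ne; rewrite addrC subrK; apply; apply: is_iso_id.
Qed.

(** Locality of [End Y] gives a [g] with [g f] invertible, say with inverse
    [h].  Then [e = f h g] is a nonzero idempotent of the local ring [End Z],
    hence the identity. *)
Lemma local_endo_not_radical Y Z (f : arr Y Z) :
  local_endo Y -> local_endo Z -> ~ in_radical f -> is_iso f.
Proof.
move=> locY locZ /existsNP [g /(local_endo_unit locY) [h [hl hr]]].
have ee : f ∘ h ∘ g ∘ (f ∘ h ∘ g) = f ∘ h ∘ g.
  by rewrite !compmA -(compmA (f ∘ h)) -(compmA f) hl compm1.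
case: (pselect (is_iso (idm Z - f ∘ h ∘ g))) => [[c [cl _]]|].
  case: (local_endo_neq0 locY); rewrite /is_zero -hl.
  (* Here 1 - e is invertible and kills e. *)
  have e0 : f ∘ h ∘ g = 0.
    by rewrite -[LHS]comp1m -cl -compmA compBl comp1m ee subrr compm0.
  have <- : h ∘ (g ∘ f) ∘ (h ∘ (g ∘ f)) = h ∘ (g ∘ f) by rewrite hl comp1m.
  have -> : h ∘ (g ∘ f) ∘ (h ∘ (g ∘ f)) = h ∘ g ∘ (f ∘ h ∘ g) ∘ f.
    by rewrite !compmA.
  by rewrite e0 compm0 comp0m.
move=> /(local_endo_unit locZ) [c [cl _]].
have e1 : f ∘ h ∘ g = idm Z by rewrite -[LHS]comp1m -cl -compmA ee cl.
by exists (h ∘ g); rewrite -compmA hl compmA e1.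
Qed.

End Basics.

(** * Direct sum decompositions *)

Section Summands.
Variables (k : comPzRingType) (C : addCat k).
Implicit Types A B D X Y Z W : C.

Definition is_biprod A B D (i : arr B A) (j : arr D A) (p : arr A B)
    (q : arr A D) : Prop :=
  [/\ p ∘ i = idm B, q ∘ j = idm D, p ∘ j = 0, q ∘ i = 0
    & i ∘ p + j ∘ q = idm A].

Lemma is_biprod_biprod A B : is_biprod (inj1 A B) (inj2 A B) (prj1 A B) (prj2 A B).
Proof.
split; [exact: prj1_inj1 | exact: prj2_inj2 | exact: prj1_inj2
       | exact: prj2_inj1 | exact: biprod_id].
Qed.

Lemma is_biprodC A B D (i : arr B A) (j : arr D A) p q :
  is_biprod i j p q -> is_biprod j i q p.
Proof. by case=> *; split=> //; rewrite addrC. Qed.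

Lemma is_biprod_iso A A' B D (f : arr A A') (i : arr B A) (j : arr D A) p q :
  is_iso f -> is_biprod i j p q ->
  exists i' j' p' q', @is_biprod A' B D i' j' p' q'.
Proof.
move=> [g [gf fg]] [pi qj pj qi e].
exists (f ∘ i), (f ∘ j), (p ∘ g), (q ∘ g); split.
- by rewrite !compmA -(compmA p) gf compm1.
- by rewrite !compmA -(compmA q) gf compm1.
- by rewrite !compmA -(compmA p) gf compm1.
- by rewrite !compmA -(compmA q) gf compm1.
- by rewrite -!compmA -compDr !compmA -compDl e comp1m.
Qed.

Lemma compAr A B D W (h : arr D W) (g : arr B D) (f : arr A B) :
  h ∘ g ∘ f = h ∘ (g ∘ f).
Proof. by rewrite compmA. Qed.

(** An equation between composites, in the two forms needed to rewrite with it in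
    right-associated composites. *)
Lemma reassoc A B D (g : arr B D) (f : arr A B) h : g ∘ f = h ->
  (g ∘ f = h) * (forall W (e : arr W A), g ∘ (f ∘ e) = h ∘ e).
Proof. by move=> e; split=> // W x; rewrite compmA e. Qed.

Definition zsimp := (oppr0, addr0, add0r, subr0, sub0r, subrr).

Definition reassoc_biprod A B D (i : arr B A) (j : arr D A) p q
    (b : is_biprod i j p q) :=
  let: And5 a1 a2 a3 a4 _ := b in
  (reassoc a1, reassoc a2, reassoc a3, reassoc a4).

(** Reassociation: from [A = B + D] and [D = B' + D'] to [A = B' + (B + D')]. *)
Lemma is_biprod_swap A B D B' D' (i : arr B A) (j : arr D A) p q
    (i' : arr B' D) (j' : arr D' D) p' q' :
  is_biprod i j p q -> is_biprod i' j' p' q' ->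
  is_biprod (j ∘ i') (i ∘ prj1 B D' + j ∘ j' ∘ prj2 B D')
            (p' ∘ q) (inj1 B D' ∘ p + inj2 B D' ∘ q' ∘ q).
Proof.
move=> b b'; have b0 := is_biprod_biprod B D'.
have S := (reassoc_biprod b, reassoc_biprod b', reassoc_biprod b0, comp_simp, compAr).
case: b b' b0 S => _ _ _ _ e [_ _ _ _ e'] [_ _ _ _ e0] S.
split; rewrite ?S ?zsimp //.
by rewrite addrCA -compDr -compAr -(compAr j') -compDl e' comp1m.
Qed.

Lemma sub_cancel A B (x y z : arr A B) : x + (z - y - (x - y)) = z.
Proof. by rewrite opprB subrKA addrC subrK. Qed.

(** The new inclusion of the complement is the old one corrected by [i t j], so
    that [t] kills it. *)
Lemma is_biprod_retraction A B D (i : arr B A) (j : arr D A) p q t :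
  is_biprod i j p q -> t ∘ i = idm B ->
  is_biprod i (j - i ∘ t ∘ j) t q.
Proof.
move=> b ti; have S := (reassoc_biprod b, reassoc ti, comp_simp, compAr).
case: b S => _ _ _ _ e S; split; rewrite ?S ?zsimp //.
have -> : j ∘ q = idm A - i ∘ p by rewrite -e addrC addKr.
by rewrite !S sub_cancel.
Qed.

(** Since [t] inverts the component [p s], the summand [i] can be exchanged for
    [s]; the projection to the complement is corrected so as to kill [s]. *)
Lemma is_biprod_section A B D Y (i : arr B A) (j : arr D A) p q
    (s : arr Y A) (t : arr B Y) :
  is_biprod i j p q -> t ∘ (p ∘ s) = idm Y -> p ∘ s ∘ t = idm B ->
  is_biprod s j (t ∘ p) (q - q ∘ s ∘ t ∘ p).
Proof.
move=> b ts; rewrite compAr => st.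
have S := (reassoc_biprod b, reassoc ts, comp_simp, compAr).
case: b S => _ _ _ _ e S; split; rewrite ?S ?zsimp //.
have -> : j ∘ q = idm A - i ∘ p by rewrite -e addrC addKr.
have -> : j ∘ (q ∘ (s ∘ (t ∘ p))) = s ∘ (t ∘ p) - i ∘ p.
  rewrite -(compAr j) -[j ∘ q](addKr (i ∘ p)) e addrC compBl comp1m.
  by rewrite compAr -(compAr s) -(compAr p) st comp1m.
by rewrite sub_cancel.
Qed.

(** Summands are split off one at a time, so that a complement of each of them is
    found by induction. *)
Fixpoint local_sum (m : nat) (A : C) : Prop :=
  if m is m'.+1 then
    exists Y B i j p q,
      [/\ @is_biprod A Y B i j p q, local_endo Y & local_sum m' B]
  else is_zero A.

(** The identity of [A] is the sum of the idempotents cutting out the local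
    summands, each of which has a complement with one summand fewer.  Taking for
    [I] the condition that a composite with a fixed morphism is radical, or zero,
    reduces such questions to single summands. *)
Lemma local_sum_ind m A (I : arr A A -> Prop) :
  local_sum m A -> I 0 -> (forall x y, I x -> I y -> I (x + y)) ->
  (forall m' Y B i j p q, m = m'.+1 -> @is_biprod A Y B i j p q ->
     local_endo Y -> local_sum m' B -> I (i ∘ p)) ->
  I (idm A).
Proof.
elim: m A I => [|m IH] A I; first by move=> /= zA I0 _ _; rewrite zA.
move=> [Y [B [i [j [p [q [b locY sumB]]]]]]] I0 ID Isum.
case: (b) => _ _ _ _ <-; apply: (ID (i ∘ p) (j ∘ q)); first exact: Isum (erefl _) b locY sumB.
have -> : j ∘ q = j ∘ idm B ∘ q by rewrite compm1.
apply: (IH B (fun e => I (j ∘ e ∘ q)) sumB).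
- by rewrite compm0 comp0m.
- by move=> x y Ix Iy; rewrite compDr compDl; apply: ID.
move=> m' Y' B' i' j' p' q' mE b' locY' sumB'.
have -> : j ∘ (i' ∘ p') ∘ q = (j ∘ i') ∘ (p' ∘ q) by rewrite !compmA.
apply: Isum (erefl _) (is_biprod_swap b b') locY' _.
rewrite mE; exists Y, B', (inj1 _ _), (inj2 _ _), (prj1 _ _), (prj2 _ _).
by split=> //; apply: is_biprod_biprod.
Qed.

End Summands.

(** * Krull-Schmidt categories *)

Section RadicalSplitting.
Variables (k : comPzRingType) (C : addCat k).
Implicit Types A B D X Y Z W : C.

Lemma is_zero_iso A B (f : arr A B) : is_iso f -> is_zero A -> is_zero B.
Proof. by move=> [g [_ fg]] zA; rewrite /is_zero -fg -(compm1 f) zA compm0 comp0m. Qed.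

Lemma krull_schmidt_local_sum : krull_schmidt C -> forall X, exists m, local_sum m X.
Proof.
move=> KS X; have [m [Y [locY]]] := KS X; elim: m Y locY X => [|m IH] Y locY X.
  rewrite big_ord0 => -[f [g [gf fg]]]; exists 0%N; apply: (@is_zero_iso zero_ob _ g).
    by exists f.
  exact: zero_obP.
rewrite big_ord_recl => -[f [g [gf fg]]]; set B := \big[_/_]_(_ < _) _ in f g gf fg.
have [m' sumB] : exists m, local_sum m B.
  apply: (IH (fun i => Y (lift ord0 i))) => [i|]; first exact: locY.
  by exists (idm B); apply: is_iso_id.
have g_iso : is_iso g by exists f.
have [i [j [p [q b]]]] := is_biprod_iso g_iso (is_biprod_biprod (Y ord0) B).
by exists m'.+1, (Y ord0), B, i, j, p, q.
Qed.

Lemma nonradical_source m A B (h : arr A B) :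
  local_sum m A -> ~ in_radical h ->
  exists m' Y A' i j p q,
    [/\ m = m'.+1, @is_biprod _ _ A Y A' i j p q, local_endo Y, local_sum m' A'
      & ~ in_radical (h ∘ i)].
Proof.
move=> sumA; apply: contra_notP => none; rewrite -[h]compm1.
apply: (local_sum_ind (I := fun e => in_radical (h ∘ e)) sumA).
- by rewrite compm0; apply: in_radical0.
- by move=> x y rx ry; rewrite compDr; apply: in_radicalD.
move=> m' Y A' i j p q mE b locY sumA'; rewrite compmA; apply: in_radical_compr.
by apply: contrapT => nr; apply: none; exists m', Y, A', i, j, p, q.
Qed.

Lemma nonradical_target m A B (h : arr A B) :
  local_sum m B -> ~ in_radical h ->
  exists m' Z B' i j p q,
    [/\ m = m'.+1, @is_biprod _ _ B Z B' i j p q, local_endo Z, local_sum m' B'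
      & ~ in_radical (p ∘ h)].
Proof.
move=> sumB; apply: contra_notP => none; rewrite -[h]comp1m.
apply: (local_sum_ind (I := fun e => in_radical (e ∘ h)) sumB).
- by rewrite comp0m; apply: in_radical0.
- by move=> x y rx ry; rewrite compDl; apply: in_radicalD.
move=> m' Z B' i j p q mE b locZ sumB'; rewrite compAr; apply: in_radical_compl.
by apply: contrapT => nr; apply: none; exists m', Z, B', i, j, p, q.
Qed.

(** Gaussian elimination: a component of [h] between local summands outside the
    radical is invertible.  Taking [h s] as the new summand of [B], and the
    retraction [r h] as the new projection of [A], makes [h] diagonal with an
    identity block. *)
Lemma nonradical_split a b A B (h : arr A B) :
  local_sum a A -> local_sum b B -> ~ in_radical h ->
  exists a' b' Y A' B' (s : arr Y A) (j : arr A' A) (q : arr A A')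
      (r : arr B Y) (j' : arr B' B) (q' : arr B B'),
    [/\ a = a'.+1 /\ b = b'.+1, local_sum a' A', local_sum b' B',
        is_biprod s j (r ∘ h) q & is_biprod (h ∘ s) j' r q'].
Proof.
move=> sumA sumB /(nonradical_source sumA).
move=> [a' [Y [A' [i [j [p [q [aE bA locY sumA']]]]]]]] /(nonradical_target sumB).
move=> [b' [Z [B' [i' [j' [p' [q' [bE bB locZ sumB']]]]]]]].
move=> /(local_endo_not_radical locY locZ) [t [tl tr]].
exists a', b', Y, A', B', i, (j - i ∘ (t ∘ p' ∘ h) ∘ j), q, (t ∘ p'), j'.
exists (q' - q' ∘ (h ∘ i) ∘ t ∘ p'); split=> //.
  by apply: is_biprod_retraction bA _; rewrite -tl !compmA.
exact: is_biprod_section bB tl tr.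
Qed.

Lemma nonzero_source m A B (h : arr A B) :
  local_sum m A -> h <> 0 -> exists Y (i : arr Y A), local_endo Y /\ h ∘ i <> 0.
Proof.
move=> sumA; apply: contra_notP => none; rewrite -[h]compm1.
apply: (local_sum_ind (I := fun e => h ∘ e = 0) sumA).
- by rewrite compm0.
- by move=> x y hx hy; rewrite compDr hx hy addr0.
move=> m' Y A' i j p q mE b locY sumA'.
suff -> : h ∘ (i ∘ p) = 0 ∘ p by rewrite comp0m.
by rewrite compmA; congr (_ ∘ _); apply: contrapT => nz; apply: none; exists Y, i.
Qed.

Lemma nonzero_target m A B (h : arr A B) :
  local_sum m B -> h <> 0 -> exists Z (p : arr B Z), local_endo Z /\ p ∘ h <> 0.
Proof.
move=> sumB; apply: contra_notP => none; rewrite -[h]comp1m.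
apply: (local_sum_ind (I := fun e => e ∘ h = 0) sumB).
- by rewrite comp0m.
- by move=> x y hx hy; rewrite compDl hx hy addr0.
move=> m' Z B' i j p q mE b locZ sumB'.
suff -> : i ∘ p ∘ h = i ∘ 0 by rewrite compm0.
by rewrite compAr; congr (_ ∘ _); apply: contrapT => nz; apply: none; exists Z, p.
Qed.

Lemma local_endo_iso X Y (f : arr X Y) : is_iso f -> local_endo Y -> local_endo X.
Proof.
move=> f_iso [nz loc]; have [g [gf fg]] := f_iso; have g_iso : is_iso g by exists f.
split=> [zX|a b na nb ab]; first exact: nz (is_zero_iso f_iso zX).
(* Conjugation by [f] carries non-units to non-units. *)
have conj (a' : arr X X) : is_iso (f ∘ a' ∘ g) -> is_iso a'.
  move=> ia; have -> : a' = g ∘ (f ∘ a' ∘ g) ∘ f.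
    by rewrite !compmA gf comp1m compAr gf compm1.
  by apply: is_iso_comp => //; apply: is_iso_comp.
apply: (loc (f ∘ a ∘ g) (f ∘ b ∘ g)); [by move/conj | by move/conj |].
by rewrite -compDl -compDr; apply: is_iso_comp => //; apply: is_iso_comp.
Qed.

Lemma indecomposable_local_endo X :
  krull_schmidt C -> indecomposable X -> local_endo X.
Proof.
move=> KS [nz indec]; have [[|m]] := krull_schmidt_local_sum KS X; first by [].
move=> [Y [B [i [j [p [q [[pi qj pj qi e] locY sumB]]]]]]].
have : is_zero Y \/ is_zero B.
  apply: indec; exists (inj1 Y B ∘ p + inj2 Y B ∘ q), (i ∘ prj1 Y B + j ∘ prj2 Y B).
  have S := (reassoc pi, reassoc qj, reassoc pj, reassoc qi,
             reassoc_biprod (is_biprod_biprod Y B), comp_simp, compAr).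
  by split; rewrite ?S ?zsimp ?biprod_id ?S.
case=> [zY|zB]; first by case: (local_endo_neq0 locY).
apply: (@local_endo_iso X Y p) => //; exists i; split=> //.
by rewrite -e (to_zero_eq q 0 zB) compm0 addr0.
Qed.

End RadicalSplitting.

(** * Exact pairs and connecting morphisms *)

Section Exactness.
Variables (k : comPzRingType) (C : addCat k).
Implicit Types A B D X Y Z W : C.

(** Weak kernel and weak cokernel at once, so that the notion is self-dual. *)
Definition exact_pair A B D (f : arr A B) (g : arr B D) : Prop :=
  [/\ g ∘ f = 0,
      forall W (u : arr W B), g ∘ u = 0 -> exists v, u = f ∘ v &
      forall W (u : arr B W), u ∘ f = 0 -> exists v, u = v ∘ g].

(** This property of angulated categories is self-dual, and it is all that the
    construction of connecting morphisms takes from the angulation. *)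
Definition extends_exactly : Prop :=
  forall A B (f : arr A B),
    (exists D (g : arr B D), exact_pair f g) /\
    (exists D (g : arr D A), exact_pair g f).

Definition has_local_sources : Prop :=
  forall A B (h : arr A B), h <> 0 ->
    exists Y (i : arr Y A), local_endo Y /\ h ∘ i <> 0.
Definition has_local_targets : Prop :=
  forall A B (h : arr A B), h <> 0 ->
    exists Z (p : arr B Z), local_endo Z /\ p ∘ h <> 0.

(** For [X] with local endomorphism ring: the simple functor C(-,X)/rad(-,X) is
    the image of the morphism C(-,X) -> coker C(-,w) induced by [y]. *)
Definition simple_presented X : Prop :=
  exists A B (w : arr A B) (y : arr X B), forall W (f : arr W X),
    ~ split_epi f <-> exists x, y ∘ f = w ∘ x.

Definition cosimple_presented X : Prop :=
  exists A B (w : arr B A) (y : arr B X), forall W (f : arr X W),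
    ~ split_mono f <-> exists x, f ∘ y = x ∘ w.

(** When [Z] is the suspension of [A], these are the conditions on the last
    morphism [d] of an angle from [A] under which its first morphism is left
    almost split and the one before [d] is right almost split. *)
Definition almost_split_connecting X Z (d : arr X Z) : Prop :=
  (forall W (f : arr W X), d ∘ f = 0 <-> ~ split_epi f) /\
  (forall W (f : arr Z W), f ∘ d = 0 <-> ~ split_mono f).

(** A morphism [f] into [X] is not a split epimorphism iff [y f] factors through
    [w], so the first component of a weak kernel of [(y, -w)] is right almost
    split. *)
Lemma right_almost_split_exists X :
  extends_exactly -> simple_presented X ->
  exists K (f : arr K X), right_almost_split f.
Proof.
move=> ext [A [B [w [y yP]]]].
have [_ [K [c [cK ker _]]]] := ext _ _ (y ∘ prj1 X A - w ∘ prj2 X A).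
have S := (reassoc_biprod (is_biprod_biprod X A), comp_simp, compAr).
exists K, (prj1 X A ∘ c); split=> [|W u /yP [x xP]].
  apply/yP; exists (prj2 X A ∘ c); apply/eqP; rewrite -subr_eq0 !compmA.
  by rewrite -compBl cK.
have [|v vP] := ker W (inj1 X A ∘ u + inj2 X A ∘ x).
  by rewrite !S ?zsimp xP subrr.
by exists v; rewrite -compmA -vP !S zsimp.
Qed.

(** A weak cokernel of a right almost split morphism is nonzero and kills the
    radical, and so does a nonzero component [d] of it with local target [Z].  If
    [g d] is nonzero, the weak kernel of [g d] is not a split epimorphism, so [d]
    kills it and [d = v g d] for some [v].  Hence [1 - v g] kills the nonzero
    [d], so that [v g] is a unit of [End Z] and [g] is a split monomorphism. *)
Lemma almost_split_connecting_exists X :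
  extends_exactly -> has_local_targets -> simple_presented X ->
  exists Z (d : arr X Z), local_endo Z /\ almost_split_connecting d.
Proof.
move=> ext tgt /(right_almost_split_exists ext) [K [f [nf fP]]].
have [[D [c [cf ker _]]] _] := ext _ _ f.
have c_neq0 : c <> 0.
  move=> c0; apply: nf; have [|s sP] := ker X (idm X); last by exists s.
  by rewrite c0 comp0m.
have [Z [p [locZ pc_neq0]]] := tgt _ _ _ c_neq0.
exists Z, (p ∘ c); split=> //.
have d_rad W (g : arr W X) : p ∘ c ∘ g = 0 <-> ~ split_epi g.
  split=> [dg [s gs]|/fP [v ->]].
    by apply: pc_neq0; rewrite -[LHS]compm1 -gs compmA dg comp0m.
  by rewrite compAr (compmA c) cf comp0m compm0.
split=> // W g; split=> [gd [r rg]|ng].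
  by apply: pc_neq0; rewrite -[LHS]comp1m -rg compAr gd compm0.
apply: contrapT => gd_neq0.
(* [l] is a weak kernel of [g d], and [g d] a weak cokernel of [l]. *)
have [_ [L [l [gdl _ coker]]]] := ext _ _ (g ∘ (p ∘ c)).
have [|v dE] := coker Z (p ∘ c).
  apply/d_rad => -[s ls]; apply: gd_neq0.
  by rewrite -[LHS]compm1 -ls compmA gdl comp0m.
have nvg : ~ is_iso (v ∘ g).
  by move=> [h [hvg _]]; apply: ng; exists (h ∘ v); rewrite compAr.
have [|h [hl _]] := @local_endo_unit _ _ _ (idm Z - v ∘ g) locZ.
  by rewrite subKr.
apply: pc_neq0; rewrite -[LHS]comp1m -hl compAr compBl comp1m.
by rewrite compAr -dE subrr compm0.
Qed.

End Exactness.

(** * The opposite category *)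

Program Definition op_cat (k : comPzRingType) (C : addCat k) : addCat k :=
  @AddCat k C (fun A B => arr B A) (fun A => idm A) (fun A B D g f => f ∘ g)
    _ _ _ _ _ zero_ob (@zero_obP k C) (fun A B => A ⊕ B)
    (fun A B => prj1 A B) (fun A B => prj2 A B)
    (fun A B => inj1 A B) (fun A B => inj2 A B)
    _ _ _ _ _.
Next Obligation. by move=> k C A B D F h g f; apply/esym/compmA. Qed.
Next Obligation. by move=> k C A B f; apply: compm1. Qed.
Next Obligation. by move=> k C A B f; apply: comp1m. Qed.
Next Obligation. by move=> k C A B D f; apply: comp_linearr. Qed.
Next Obligation. by move=> k C A B D f; apply: comp_linearl. Qed.
Next Obligation. by move=> k C A B; apply: prj1_inj1. Qed.
Next Obligation. by move=> k C A B; apply: prj2_inj2. Qed.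
Next Obligation. by move=> k C A B; apply: prj2_inj1. Qed.
Next Obligation. by move=> k C A B; apply: prj1_inj2. Qed.
Next Obligation. by move=> k C A B; apply: biprod_id. Qed.

Section Opposite.
Variables (k : comPzRingType) (C : addCat k).

Lemma op_is_iso (A B : C) (f : arr A B) : @is_iso k (op_cat C) B A f <-> is_iso f.
Proof. by split=> -[g [gf fg]]; exists g. Qed.

Lemma op_local_endo (X : C) : @local_endo k (op_cat C) X <-> local_endo X.
Proof.
split=> -[nz loc]; split=> // f g nf ng.
  by move/op_is_iso; apply: loc; move/op_is_iso.
by move/op_is_iso; apply: loc; move/op_is_iso.
Qed.

Lemma op_exact_pair (A B D : C) (f : arr A B) (g : arr B D) :
  exact_pair f g -> @exact_pair k (op_cat C) D B A g f.
Proof. by case. Qed.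

Lemma op_extends_exactly : extends_exactly C -> extends_exactly (op_cat C).
Proof.
move=> ext A B f; have [[D [g fg]] [F [h hf]]] := ext B A f.
split; [exists F, h | exists D, g]; exact: op_exact_pair.
Qed.

Lemma op_has_local_targets : has_local_sources C -> has_local_targets (op_cat C).
Proof.
move=> src A B h /(src B A h) [Y [i [locY hi]]]; exists Y, i; split=> //.
exact/op_local_endo.
Qed.

Lemma almost_split_connecting_exists_dual (X : C) :
  extends_exactly C -> has_local_sources C -> cosimple_presented X ->
  exists Z (d : arr Z X), local_endo Z /\ almost_split_connecting d.
Proof.
move=> /op_extends_exactly ext /op_has_local_targets tgt pres.
have [Z [d [locZ [dl dr]]]] :=
  @almost_split_connecting_exists k (op_cat C) X ext tgt pres.
by exists Z, d; split=> //; apply/op_local_endo.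
Qed.

End Opposite.

(** * Functionals on modules *)

Section Submodules.
Variables (k : comPzRingType) (M : lmodType k) (S : M -> Prop).

(** The closure proof is an argument so that the module structure on the
    submodule, which depends on it, can be inferred from the type. *)
Definition submod_pred (_ : submodule S) : {pred M} := fun x => `[<S x>].

Lemma submod_pred_closed (hS : submodule S) :
  GRing.submod_closed (submod_pred hS).
Proof.
case: (hS) => S0 SD SZ; split; first exact/asboolP.
move=> a x y /asboolP Sx /asboolP Sy; apply/asboolP; apply: SD => //.
exact: SZ.
Qed.

HB.instance Definition _ (hS : submodule S) :=
  GRing.isSubmodClosed.Build k M (submod_pred hS) (submod_pred_closed hS).

Definition submod_of (hS : submodule S) := {x : M | x \in submod_pred hS}.

HB.instance Definition _ (hS : submodule S) := SubType.on (submod_of hS).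
HB.instance Definition _ (hS : submodule S) := Choice.on (submod_of hS).
HB.instance Definition _ (hS : submodule S) :=
  [SubChoice_isSubLmodule of submod_of hS by <:].

Lemma injective_module_extend (E : lmodType k) (g : M -> E) :
  injective_module E -> submodule S ->
  (forall a x y, S x -> S y -> g (a *: x + y) = a *: g x + g y) ->
  exists phi : {linear M -> E}, forall x, S x -> phi x = g x.
Proof.
move=> injE hS gl.
have SP (x : submod_of hS) : S (val x) by apply/asboolP/(valP x).
pose g' (x : submod_of hS) : E := g (val x).
have g'l : linear g' by move=> a x y; rewrite /g' linearP; apply: gl; apply: SP.
pose G : {linear submod_of hS -> E} := HB.pack g'
  (GRing.isLinear.Build k (submod_of hS) E _ g' g'l).
pose V : {linear submod_of hS -> M} := val.
have [phi phiP] := injE _ _ V G val_inj.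
exists phi => x Sx.
have xP : x \in submod_pred hS by apply/asboolP.
exact: (phiP (Sub x xP)).
Qed.

End Submodules.

(** * Prime ideals of an Artinian ring *)

Section ArtinianPrimes.
Variables (k : comPzRingType) (artin : artinian k).

Definition prime_ideal (I : k -> Prop) : Prop :=
  [/\ ideal I, ~ I 1 & forall a b, ~ I a -> ~ I b -> ~ I (a * b)].

Lemma ideal_mull (I : k -> Prop) a x : ideal I -> I x -> I (a * x).
Proof. by case=> _ _ + Ix; apply. Qed.

Lemma principal_ideal (x : k) : ideal (fun z => exists c, z = c * x).
Proof.
split; first by exists 0; rewrite mul0r.
  by move=> _ _ [c ->] [d ->]; exists (c + d); rewrite mulrDl.
by move=> a _ [c ->]; exists (a * c); rewrite -mulrA.
Qed.

(** If [y] is outside [I] but in a proper ideal [J] above it, then stationarity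
    of the chain of the [(y^n)] gives [y^m (1 - c y) = 0], so that [1 - c y] is
    in [I], hence in [J], and so is 1. *)
Lemma artinian_prime_maximal (I : k -> Prop) : prime_ideal I -> maximal_ideal I.
Proof.
move=> [idI nI1 prI]; split=> // J idJ nJ1 IJ y Jy; apply: contrapT => nIy.
have [|m mP] := artin (fun m => principal_ideal (y ^+ m)).
  by move=> i _ [c ->]; exists (c * y); rewrite exprS mulrA.
have [|c cP] := mP m.+1 (leqnSn m) (y ^+ m); first by exists 1; rewrite mul1r.
have nIyn j : ~ I (y ^+ j).
  by elim: j => [|j IH]; rewrite ?expr0 ?exprS //; apply: prI.
have I1cy : I (1 - c * y).
  apply: contrapT => /(prI _ _ (nIyn m)); apply.
  by rewrite mulrBr mulr1 mulrCA -exprSr -cP subrr; case: idI.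
apply: nJ1; rewrite -(subrK (c * y) 1); case: (idJ) => _ JD _.
by apply: JD; [apply: IJ | apply: ideal_mull].
Qed.

(** In other words, k/rad k has a nonzero element killed by [I].  Take [x] outside
    [I] with [(x)] minimal.  If [a x] were outside a maximal
    ideal [J] for some [a] in [I], then [J] would contain a [y] outside [I];
    by minimality [x] would be a multiple of [x y], hence in [J]. *)
Lemma artinian_prime_socle (I : k -> Prop) : prime_ideal I ->
  exists x, ~ jacobson x /\ forall a, I a -> jacobson (a * x).
Proof.
move=> prI; have maxI := artinian_prime_maximal prI.
case: (prI) => idI nI1 Imul.
apply: contrapT => none.
have step x : exists y, ~ I x -> ~ I (x * y) /\ forall c, x <> c * (x * y).
  case: (pselect (I x)) => [Ix|nIx]; first by exists 0.
  have [a /not_implyP [Ia /existsNP [J /not_implyP [maxJ nJax]]]] :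
      exists a, ~ (I a -> jacobson (a * x)).
    apply/existsNP => all; apply: none; exists x; split=> //.
    by move=> /(_ I maxI).
  case: (maxJ) => idJ nJ1 topJ.
  have [y /not_implyP [Jy nIy]] : exists y, ~ (J y -> I y).
    apply/existsNP => JI; apply: nJax; rewrite mulrC; apply: ideal_mull => //.
    exact: topJ JI a Ia.
  exists y => _; split=> [|c xE]; first exact: Imul.
  apply: nJax; apply: ideal_mull => //; rewrite xE mulrA.
  exact: ideal_mull.
have [f fP] := choice step.
(* Without a minimal [(x)], iterating [step] gives a strictly decreasing chain. *)
pose x := fix x m := if m is m'.+1 then x m' * f (x m') else 1.
have nIx m : ~ I (x m) by elim: m => //= m /fP [].
have [|m mP] := artin (fun m => principal_ideal (x m)).
  by move=> i _ [c ->]; exists (c * f (x i)) => /=; rewrite -mulrA (mulrC (f _)).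
have [|c cP] := mP m.+1 (leqnSn m) (x m); first by exists 1; rewrite mul1r.
by have [_ /(_ c)] := fP _ (nIx m).
Qed.

End ArtinianPrimes.

(** * Presentations of simple functors over a dualizing variety *)

Section Presentations.
Variables (k : comPzRingType) (artin : artinian k) (E : lmodType k).
Variable (E_top : injective_envelope_of_top E).
Variable (C : addCat k).
Implicit Types X Y : C.

Lemma is_isoZ X Y a (f : arr X Y) : is_iso (a *: f) -> is_iso f.
Proof.
by move=> [g [gf fg]]; exists (a *: g); move: gf fg; rewrite !compZl !compZr.
Qed.

Lemma nonunits_submodule X :
  local_endo X -> submodule (fun f : arr X X => ~ is_iso f).
Proof.
move=> [nz loc]; split; first by move=> [g []]; rewrite compm0 => /esym /nz.
  exact: loc.
by move=> a f nf /is_isoZ.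
Qed.

(** The scalars acting on [X] as non-units form a prime ideal [I], so [E] has a
    nonzero element [e] killed by [I].  The functional sends [a + n], with [a]
    scalar and [n] a non-unit, to [a e]; injectivity extends it to [End X]. *)
Lemma local_endo_functional X : local_endo X ->
  exists phi : {linear arr X X -> E},
    phi (idm X) <> 0 /\ forall f, ~ is_iso f -> phi f = 0.
Proof.
move=> locX; have [N0 ND NZ] := nonunits_submodule locX.
have NN (f : arr X X) : ~ is_iso f -> ~ is_iso (- f).
  by rewrite -scaleN1r; apply: NZ.
pose I (a : k) := ~ is_iso (a *: idm X).
have prI : prime_ideal I.
  split.
  - split; first by rewrite /I scale0r.
      by move=> a b Ia Ib; rewrite /I scalerDl; apply: ND.
    by move=> a b Ib; rewrite /I -[a *: b]/(a * b) -scalerA; apply: NZ.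
  - by rewrite /I scale1r; apply; apply: is_iso_id.
  move=> a b /contrapT ua /contrapT ub; apply.
  have -> : (a * b) *: idm X = (a *: idm X) ∘ (b *: idm X).
    by rewrite compZl compZr compm1 scalerA.
  exact: is_iso_comp.
have [x [nJx JIx]] := artinian_prime_socle artin prI.
have [Q [p [j [[p_surj pJ] [injE j_inj _]]]]] := E_top.
pose e := j (p x).
have e_neq0 : e <> 0.
  by move=> e0; apply: nJx; apply/pJ; apply: j_inj; rewrite -/e e0 linear0.
have Ie a : I a -> a *: e = 0.
  by move=> /JIx /pJ Ja; rewrite /e -!linearZ; move: Ja => /= ->; rewrite linear0.
pose S (f : arr X X) := exists a, ~ is_iso (f - a *: idm X).
have [g gP] : exists g : arr X X -> E,
    forall f a, ~ is_iso (f - a *: idm X) -> g f = a *: e.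
  have uniq_val (f : arr X X) a b : ~ is_iso (f - a *: idm X) ->
      ~ is_iso (f - b *: idm X) -> a *: e = b *: e.
    move=> na nb; apply/eqP; rewrite -subr_eq0 -scalerBl; apply/eqP/Ie.
    rewrite /I scalerBl.
    have -> : a *: idm X - b *: idm X = (f - b *: idm X) - (f - a *: idm X).
      by rewrite opprB [RHS]addrC subrKA.
    by apply: ND => //; apply: NN.
  have value f : exists z, S f -> exists2 a, ~ is_iso (f - a *: idm X) & z = a *: e.
    case: (pselect (S f)) => [[a na]|nS]; last by exists 0.
    by exists (a *: e) => _; exists a.
  have [g gP] := choice value.
  exists g => f a na; have [|b nb ->] := gP f; first by exists a.
  exact: uniq_val nb na.
have subS : submodule S.
  split; first by exists 0; rewrite scale0r subr0.
    move=> f h [a na] [b nb]; exists (a + b).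
    by rewrite scalerDl opprD addrACA; apply: ND.
  move=> c f [a na]; exists (c * a); rewrite -scalerA -scalerBr; exact: NZ.
have [|phi phiP] := @injective_module_extend _ _ S E g injE subS.
  move=> c f h [a na] [b nb]; rewrite (gP f a) // (gP h b) //.
  rewrite scalerA -scalerDl; apply: gP.
  by rewrite scalerDl opprD addrACA; apply: ND => //; rewrite -scalerA -scalerBr; apply: NZ.
exists phi; split=> [|f nf].
  rewrite phiP; last by exists 1; rewrite scale1r subrr.
  by rewrite (gP _ 1) ?scale1r ?subrr.
rewrite phiP; last by exists 0; rewrite scale0r subr0.
by rewrite (gP _ 0) ?scale0r ?subr0.
Qed.

(** Presented by the zero object: C(X,-) is the cokernel of C(0,-) -> C(X,-). *)
Lemma fp_hom_from X : fp_co (hom_from X).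
Proof.
pose z : arr X (zero_ob : C) := 0.
exists zero_ob, X.
unshelve eexists.
  unshelve econstructor; first exact: (fun Y => @precomp _ _ Y _ _ z).
  by move=> Y Y' f x /=; rewrite /precomp /postcomp compmA.
unshelve eexists.
  by unshelve econstructor; first exact: (fun Y => idfun).
move=> Y; split=> [y|y /=]; first by exists y.
split=> [->|[x <-]]; first by exists 0; rewrite /precomp comp0m.
by rewrite /precomp compm0.
Qed.

Lemma fp_hom_to X : fp_contra (hom_to X).
Proof.
pose z : arr (zero_ob : C) X := 0.
exists zero_ob, X.
unshelve eexists.
  unshelve econstructor; first exact: (fun Y => @postcomp _ _ Y _ _ z).
  by move=> Y Y' f x /=; rewrite /precomp /postcomp compmA.
unshelve eexists.
  by unshelve econstructor; first exact: (fun Y => idfun).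
move=> Y; split=> [y|y /=]; first by exists y.
split=> [->|[x <-]]; first by exists 0; rewrite /postcomp comp0m.
by rewrite /postcomp comp0m.
Qed.

(** A functional [phi] on [End X] as above gives a morphism from C(-,X) to
    DC(X,-), sending [f] to [g |-> phi (f g)].  Its kernel consists of the
    [f] that are not split epimorphisms, and DC(X,-) is finitely presented. *)
Lemma dualizing_simple_presented X :
  (forall G : cofun C, fp_co G -> fp_contra (dual_co E G)) ->
  local_endo X -> simple_presented X.
Proof.
move=> dual /local_endo_functional [phi [phi1 phi0]].
have [A [B [u [v exv]]]] := dual _ (fp_hom_from X).
have [y yP] := (exv X).1 (phi : linhom (arr X X) E).
exists A, B, (u A (idm A)), y => W f.
have vE g : linhom_fun (v W (y ∘ f)) g = phi (f ∘ g).
  by have := cn_natural v f y; rewrite /= /precomp => ->; rewrite yP.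
have uE x : u W x = u A (idm A) ∘ x.
  by have := cn_natural u x (idm A); rewrite /= /precomp comp1m.
split=> [nf|[x xE] [s fs]].
  have [x <-] : exists x, u W x = y ∘ f.
    apply/(exv W).2; apply: linhomP => g; rewrite vE; apply: phi0.
    move=> [h [_ fgh]]; apply: nf; exists (g ∘ h); by rewrite compmA.
  by exists x.
apply: phi1; rewrite -fs -vE.
by have -> : v W (y ∘ f) = 0 by apply/(exv W).2; exists x; rewrite uE.
Qed.

Lemma dualizing_cosimple_presented X :
  (forall F : contrafun C, fp_contra F -> fp_co (dual_contra E F)) ->
  local_endo X -> cosimple_presented X.
Proof.
move=> dual /local_endo_functional [phi [phi1 phi0]].
have [A [B [u [v exv]]]] := dual _ (fp_hom_to X).
have [y yP] := (exv X).1 (phi : linhom (arr X X) E).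
exists A, B, (u A (idm A)), y => W f.
have vE g : linhom_fun (v W (f ∘ y)) g = phi (g ∘ f).
  by have := co_natural v f y; rewrite /= /postcomp => ->; rewrite yP.
have uE x : u W x = x ∘ u A (idm A).
  by have := co_natural u x (idm A); rewrite /= /postcomp compm1.
split=> [nf|[x xE] [s fs]].
  have [x <-] : exists x, u W x = f ∘ y.
    apply/(exv W).2; apply: linhomP => g; rewrite vE; apply: phi0.
    move=> [h [hgf _]]; apply: nf; exists (h ∘ g); by rewrite compAr.
  by exists x.
apply: phi1; rewrite -fs -vE.
by have -> : v W (f ∘ y) = 0 by apply/(exv W).2; exists x; rewrite uE.
Qed.

End Presentations.

(** * Morphisms of chains *)

Section Chains.
Variables (k : comPzRingType) (C : addCat k).
Implicit Types A B D X Y Z W : C.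

(** Recursion on the chains keeps the components typed by the objects themselves,
    so that extending chains or splitting off their first morphism needs no
    transport. *)
Fixpoint chain_map (P : forall A B, arr A B -> Prop) (m : nat) :
    forall A Z B W (p : chain m A Z) (q : chain m B W),
    arr A B -> arr Z W -> Prop :=
  match m with
  | 0 => fun A Z B W p q f g => g ∘ p = q ∘ f
  | m'.+1 => fun A Z B W p q f g =>
      exists h : arr (projT1 p) (projT1 q),
        [/\ P _ _ h, h ∘ (projT2 p).1 = (projT2 q).1 ∘ f
          & chain_map P (projT2 p).2 (projT2 q).2 h g]
  end.

Definition chain_mor := chain_map (fun _ _ _ => True).
Definition chain_iso := chain_map (fun A B (f : arr A B) => is_iso f).

Lemma chain_mor_of_components m A Z B W (p : chain m A Z) (q : chain m B W)
    (phi : forall i, arr (chain_ob i p) (chain_ob i q)) (g : arr Z W) :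
  (forall i, (i < m)%N -> phi i.+1 ∘ chain_arr i p = chain_arr i q ∘ phi i) ->
  g ∘ chain_last p = chain_last q ∘ phi m ->
  chain_mor p q (phi 0%N) g.
Proof.
elim: m A B p q phi => [|m IH] A B //= [A1 [a p]] [B1 [b q]] phi phi_arr phi_last.
exists (phi 1%N); split=> //; first exact: (phi_arr 0%N).
apply: (IH _ _ p q (fun i => phi i.+1)) => [i i_lt|]; last exact: phi_last.
exact: (phi_arr i.+1).
Qed.

Lemma components_of_chain_iso m A Z B W (p : chain m A Z) (q : chain m B W) f g :
  is_iso f -> chain_iso p q f g ->
  exists phi : forall i, arr (chain_ob i p) (chain_ob i q),
    [/\ phi 0%N = f, forall i, (i <= m)%N -> is_iso (phi i),
        forall i, (i < m)%N -> phi i.+1 ∘ chain_arr i p = chain_arr i q ∘ phi i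
      & g ∘ chain_last p = chain_last q ∘ phi m].
Proof.
elim: m A B p q f => [|m IH] A B p q f f_iso.
  move=> pq; exists (fun i =>
    match i return arr (chain_ob i (p : chain 0 A Z))
                       (chain_ob i (q : chain 0 B W)) with
    | 0 => f
    | i'.+1 => g
    end).
  by split=> // -[].
case: p q => A1 [a p] [B1 [b q]] [h [h_iso /= ha]].
move=> /(IH _ _ _ _ _ h_iso) [phi [phi0 phi_iso phi_arr phi_last]].
exists (fun i =>
  match i return arr (chain_ob i (existT _ A1 (a, p) : chain m.+1 A Z))
                     (chain_ob i (existT _ B1 (b, q) : chain m.+1 B W)) with
  | 0 => f
  | i'.+1 => phi i'
  end).
split=> //; first by case=> [|i] //; apply: phi_iso.
by case=> [|i] /=; [rewrite phi0 | apply: phi_arr].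
Qed.

Lemma chain_iso_rcons m A Y Z B Y' W (p : chain m A Y) (q : chain m B Y')
    (d : arr Y Z) (e : arr Y' W) f g h :
  is_iso g -> chain_iso p q f g -> h ∘ d = e ∘ g ->
  chain_iso (chain_rcons p d) (chain_rcons q e) f h.
Proof.
elim: m A B p q f => [|m IH] A B p q f g_iso; first by exists g.
by case=> [c [c_iso ca pq]] hd; exists c; split=> //; apply: IH.
Qed.

Lemma chain_mor_last m A Y Z B Y' W (p : chain m A Y) (q : chain m B Y')
    (d : arr Y Z) (e : arr Y' W) f h :
  chain_mor (chain_rcons p d) (chain_rcons q e) f h ->
  exists c, h ∘ d = e ∘ c.
Proof.
elim: m A B p q f => [|m IH] A B p q f; first by case=> c [_ _ hd]; exists c.
by case=> c [_ _ /IH].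
Qed.

(** * Positions in an extended chain *)

(** The codomain of the [i]-th morphism of [chain_rcons p g] is that of the
    [i]-th morphism of [p] only up to a propositional equality of objects, so
    the comparison is stated through an arbitrary property. *)

Lemma chain_arr_rcons (P : forall A B, arr A B -> Prop) i m A Y Z
    (p : chain m A Y) (g : arr Y Z) : (i <= m)%N ->
  P _ _ (chain_arr i (chain_rcons p g)) <-> P _ _ (chain_arr i p).
Proof.
by elim: m i A p => [|m IH] [|i] A p //= i_le; apply: IH.
Qed.

Lemma chain_arr_rcons_last (P : forall A B, arr A B -> Prop) m A Y Z
    (p : chain m A Y) (g : arr Y Z) :
  P _ _ (chain_arr m (chain_rcons p g)) <-> P _ _ (chain_last p).
Proof. by elim: m A p => [|m IH] A p //=; apply: IH. Qed.

Lemma chain_last_rcons Z (P : forall A, arr A Z -> Prop) m A Y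
    (p : chain m A Y) (g : arr Y Z) :
  P _ (chain_last (chain_rcons p g)) <-> P _ g.
Proof. by elim: m A p => [|m IH] A p //=; apply: IH. Qed.

Lemma chain_ob_rcons_last m A Y Z (p : chain m A Y) (g : arr Y Z) :
  chain_ob m.+1 (chain_rcons p g) = Y.
Proof. by elim: m A p => [|m IH] A p //=; apply: IH. Qed.

Lemma chain_pair_rcons (P : forall A B D, arr A B -> arr B D -> Prop) i m A Y Z
    (p : chain m A Y) (g : arr Y Z) : (i < m)%N ->
  P _ _ _ (chain_arr i (chain_rcons p g)) (chain_arr i.+1 (chain_rcons p g)) <->
  P _ _ _ (chain_arr i p) (chain_arr i.+1 p).
Proof.
elim: m i A p => [|m IH] [|i] A //=; last by move=> p i_lt; apply: IH.
by case: m {IH} => [|m] [B [a p]].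
Qed.

Lemma chain_pair_rcons_last (P : forall A B D, arr A B -> arr B D -> Prop) m A Y Z
    (p : chain m A Y) (g : arr Y Z) :
  P _ _ _ (chain_arr m (chain_rcons p g)) (chain_arr m.+1 (chain_rcons p g)) <->
  P _ _ _ (chain_last p) g.
Proof. by elim: m A p => [|m IH] A p //=; apply: IH. Qed.

(** * Zero chains and direct sums of chains *)

Fixpoint zero_chain m A Z : chain m A Z :=
  if m is m'.+1 then existT _ zero_ob (0, zero_chain m' zero_ob Z) else 0.

Lemma mkchain_zero m Z :
  mkchain (W := fun _ => zero_ob) (fun _ => 0) (0 : arr zero_ob Z)
    = zero_chain m zero_ob Z.
Proof. by elim: m => //= m ->. Qed.

Lemma zero_chain_iso m A B Y Z W (f : arr A B) (g : arr Z W) :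
  is_zero Y ->
  chain_iso (zero_chain m.+1 A Z) (chain_rcons (zero_chain m B Y) 0) f g.
Proof.
move=> zY; elim: m A B f => [|m IH] A B f.
  exists 0; rewrite /= !comp_simp; split=> //.
  by apply: is_iso_zero => //; apply: zero_obP.
by exists (idm zero_ob); split; [exact: is_iso_id | rewrite /= !comp_simp | exact: IH].
Qed.

Fixpoint chain_dsum m : forall A Z B W,
    chain m A Z -> chain m B W -> chain m (A ⊕ B) (Z ⊕ W) :=
  match m with
  | 0 => fun A Z B W p q => mx2 p 0 0 q
  | m'.+1 => fun A Z B W p q =>
      existT _ (projT1 p ⊕ projT1 q)
        (mx2 (projT2 p).1 0 0 (projT2 q).1,
         chain_dsum (projT2 p).2 (projT2 q).2)
  end.

Lemma mkchain_dsum m A Y Z B Y' Z' W (p : chain m A Y) (q : chain m B Y')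
    (d : arr Y Z) (e : arr Y' Z') (u : arr Z W) (v : arr Z' W) :
  let p' := chain_rcons p d in let q' := chain_rcons q e in
  mkchain (W := fun i => chain_ob i p' ⊕ chain_ob i q')
    (fun i => mx2 (chain_arr i p') 0 0 (chain_arr i q'))
    (u ∘ (chain_last p' ∘ prj1 _ _) + v ∘ (chain_last q' ∘ prj2 _ _))
  = chain_rcons (chain_dsum p q) (u ∘ (d ∘ prj1 _ _) + v ∘ (e ∘ prj2 _ _)).
Proof.
elim: m A B p q => [|m IH] A B p q //=.
by move: (IH _ _ (projT2 p).2 (projT2 q).2) => /= ->.
Qed.

Lemma mx2_inj1 A B A' B' (a : arr A A') (b : arr B A') (c : arr A B') (d : arr B B') :
  mx2 a b c d ∘ inj1 A B = inj1 A' B' ∘ a + inj2 A' B' ∘ c.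
Proof.
have S := (reassoc_biprod (is_biprod_biprod A B), comp_simp, compAr).
by rewrite /mx2 !S ?zsimp.
Qed.

Lemma mx2_diag_col A B A' B' W (a : arr A A') (d : arr B B') (x : arr W A) (y : arr W B) :
  mx2 a 0 0 d ∘ (inj1 A B ∘ x + inj2 A B ∘ y)
    = inj1 A' B' ∘ (a ∘ x) + inj2 A' B' ∘ (d ∘ y).
Proof.
have S := (reassoc_biprod (is_biprod_biprod A B), comp_simp, compAr).
by rewrite /mx2 !S ?zsimp.
Qed.

Lemma inj1_zero_iso A Z : is_zero Z -> is_iso (inj1 A Z).
Proof.
move=> zZ; exists (prj1 A Z); split; first exact: prj1_inj1.
by rewrite -biprod_id (to_zero_eq (prj2 A Z) 0 zZ) compm0 addr0.
Qed.

Lemma is_biprod_col_iso A B D (i : arr B A) (j : arr D A) p q :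
  is_biprod i j p q -> is_iso (inj1 B D ∘ p + inj2 B D ∘ q).
Proof.
move=> b; exists (i ∘ prj1 B D + j ∘ prj2 B D).
have S := (reassoc_biprod b, reassoc_biprod (is_biprod_biprod B D), comp_simp, compAr).
case: (b) => _ _ _ _ e; split; rewrite !S ?zsimp ?e //.
exact: biprod_id.
Qed.

(** * Splitting off a contractible summand *)

Fixpoint chain_pre m : forall A B Z, chain m B Z -> arr A B -> chain m A Z :=
  match m with
  | 0 => fun A B Z p f => p ∘ f
  | m'.+1 => fun A B Z p f => existT _ (projT1 p) ((projT2 p).1 ∘ f, (projT2 p).2)
  end.

Lemma chain_dsum_zero m A Z (p : chain m A Z) :
  chain_iso p (chain_dsum p (zero_chain m zero_ob zero_ob))
    (inj1 A zero_ob) (inj1 Z zero_ob).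
Proof.
elim: m A p => [|m IH] A p; first by rewrite /chain_iso /= mx2_inj1 compm0 addr0.
exists (inj1 _ zero_ob); split; last exact: IH.
  exact/inj1_zero_iso/zero_obP.
by rewrite mx2_inj1 compm0 addr0.
Qed.

(** Induced by the splitting of the first object: the first morphism of [p]
    kills the summand [Y]. *)
Lemma chain_pre_split m A B Y Z (p : chain m A Z) (s : arr Y A) (j : arr B A) r q :
  is_biprod s j r q -> chain_arr 0 p ∘ s = 0 ->
  chain_iso p (chain_dsum (chain_pre p j) (zero_chain m Y zero_ob))
    (inj1 B Y ∘ q + inj2 B Y ∘ r) (inj1 Z zero_ob).
Proof.
move=> [_ _ _ _ e].
have square W (a : arr A W) : a ∘ s = 0 ->
    inj1 W zero_ob ∘ a
      = mx2 (a ∘ j) 0 0 (0 : arr Y zero_ob) ∘ (inj1 B Y ∘ q + inj2 B Y ∘ r).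
  move=> as0; rewrite mx2_diag_col comp0m compm0 addr0 compAr.
  by rewrite -[in LHS](compm1 a) -e compDr (compmA a s) as0 comp0m add0r.
case: m p => [|m] p /= as0; first exact: square.
exists (inj1 _ zero_ob); split; last exact: chain_dsum_zero.
  exact/inj1_zero_iso/zero_obP.
exact: square.
Qed.

Fixpoint chain_size (N m : nat) : forall A Z, chain m A Z -> Prop :=
  match m with
  | 0 => fun A Z p => N = 0%N
  | m'.+1 => fun A Z p =>
      exists a b, [/\ N = (a + b)%N, local_sum a (projT1 p)
                    & chain_size b (projT2 p).2]
  end.

Lemma chain_size_pre N m A B Z (p : chain m B Z) (f : arr A B) :
  chain_size N p -> chain_size N (chain_pre p f).
Proof. by case: m p. Qed.

Lemma chain_size_exists m A Z (p : chain m A Z) :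
  (forall X, exists a, local_sum a X) -> exists N, chain_size N p.
Proof.
move=> sz; elim: m A p => [|m IH] A p; first by exists 0%N.
have [a sza] := sz (projT1 p); have [b szb] := IH _ (projT2 p).2.
by exists (a + b)%N, a, b.
Qed.

(** Gaussian elimination at an inner morphism [h] outside the radical splits off a
    summand [Y = Y].  The neighbours of [h] vanish on it because [p] is a complex,
    so it is a direct summand of the chain; the ends are not affected. *)
Lemma chain_reduce i N m A Z (p : chain m A Z) :
  (0 < i < m)%N -> ~ in_radical (chain_arr i p) ->
  (forall i, (i < m)%N -> chain_arr i.+1 p ∘ chain_arr i p = 0) ->
  chain_size N p ->
  exists N' (q : chain m A Z) (t : chain m zero_ob zero_ob),
    [/\ (N' < N)%N, chain_size N' q
      & chain_iso p (chain_dsum q t) (inj1 A zero_ob) (inj1 Z zero_ob)].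
Proof.
case: i => // i /=; elim: i N m A p => [|i IH] N [|m] A //.
  case: m => // m [B [x [D [h r]]]] _ /= nr cplx.
  have hx := cplx 0%N isT; have rh := cplx 1%N isT.
  move=> [a [_ [-> sumB [b [c [-> sumD szr]]]]]].
  have [a' [b' [Y [B' [D' [s [j [q [u [j' [q' [[-> ->] sumB' sumD' bB bD]]]]]]]]]]]] :=
    nonradical_split sumB sumD nr.
  exists (a' + (b' + c))%N.
  exists (existT _ B' (q ∘ x, existT _ D' (q' ∘ h ∘ j, chain_pre r j'))).
  exists (existT _ Y (0, existT _ Y (idm Y, zero_chain m Y zero_ob))).
  split; first by rewrite !addSn addnS.
    exists a', (b' + c)%N; split=> //; exists b', c; split=> //.
    exact: chain_size_pre.
  exists (inj1 B' Y ∘ q + inj2 B' Y ∘ (u ∘ h)); split.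
  - exact: is_biprod_col_iso (is_biprodC bB).
  - by rewrite mx2_inj1 compm0 compDl !compAr hx !compm0 compmA.
  exists (inj1 D' Y ∘ q' + inj2 D' Y ∘ u); split.
  - exact: is_biprod_col_iso (is_biprodC bD).
  - rewrite /= mx2_diag_col comp1m compDl !compAr; congr (_ + _).
    case: bB bD => _ _ _ _ eB [_ _ _ qs _].
    congr (_ ∘ _); rewrite -[in LHS](compm1 h) -eB !compDr !compmA.
    by rewrite -(compmA q') qs !comp0m add0r.
  by apply: chain_pre_split bD _; rewrite compmA rh comp0m.
case: m => // m [B [x p]] im /= nr cplx [a [b [-> sumB szp]]].
have [|N' [q [t [lt szq pqt]]]] := IH b m.+1 B p im nr _ szp.
  by move=> i' i_lt; apply: (cplx i'.+1).
exists (a + N')%N, (existT _ B (x, q)), (existT _ zero_ob (0, t)).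
split; first by rewrite ltn_add2l.
  by exists a, N'.
exists (inj1 B zero_ob); split=> //; first exact/inj1_zero_iso/zero_obP.
by rewrite mx2_inj1 compm0 addr0.
Qed.

End Chains.

(** * The suspension *)

Section Automorphism.
Variables (k : comPzRingType) (C : addCat k) (S : automorphism C).
Implicit Types A B X Y : C.

Lemma smap0 A B : smap S (0 : arr A B) = 0.
Proof. by apply: (addrI (smap S (0 : arr A B))); rewrite -smapD !addr0. Qed.

Lemma smap_inj A B : injective (@smap _ _ S A B).
Proof. exact/bij_inj/smap_bij. Qed.

Lemma smap_surj A B (g : arr (S A) (S B)) : exists f : arr A B, g = smap S f.
Proof. by have [h hK Kh] := smap_bij S A B; exists (h g); rewrite Kh. Qed.

Lemma sus_surj X : exists A, X = S A.
Proof. by have [s sK Ks] := sus_bij S; exists (s X); rewrite Ks. Qed.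

Lemma is_zero_sus A : is_zero A -> is_zero (S A).
Proof. by rewrite /is_zero -smap1 => ->; apply: smap0. Qed.

Lemma smap_iso A B (f : arr A B) : is_iso (smap S f) <-> is_iso f.
Proof.
split=> -[g [gf fg]]; last first.
  by exists (smap S g); rewrite -!smapM gf fg !smap1.
have [g' gE] := smap_surj g; exists g'.
by split; apply: smap_inj; rewrite smapM smap1 -gE.
Qed.

Lemma smap_split_mono A B (f : arr A B) : split_mono (smap S f) <-> split_mono f.
Proof.
split=> -[r rf]; last by exists (smap S r); rewrite -smapM rf smap1.
have [r' rE] := smap_surj r; exists r'.
by apply: smap_inj; rewrite smapM smap1 -rE.
Qed.

Lemma local_endo_sus A : local_endo A -> local_endo (S A).
Proof.
move=> [nz loc]; split=> [|f g]; first by rewrite -smap1 -(smap0 A A) => /smap_inj.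
have [f' ->] := smap_surj f; have [g' ->] := smap_surj g.
by rewrite -smapD => nf ng /smap_iso; apply: loc => /smap_iso.
Qed.

End Automorphism.

(** * Angles *)

Section Angles.
Variables (k : comPzRingType) (C : addCat k) (n : nat) (T : angulated C n.+1).
Local Notation S := (susp T).
Implicit Types A B X Y Z W : C.

Definition is_angle A (p : chain n.+2 A (S A)) : Prop :=
  angle (a := T) (existT (fun X => chain n.+2 X (S X)) A p).

Local Notation sgn := ((-1) ^+ n.+1).

Lemma sgn_cancel A B (f : arr A B) : sgn *: (sgn *: f) = f.
Proof. by rewrite scalerA -exprD addnn -mul2n exprM sqrrN !expr1n scale1r. Qed.

Lemma angle_rot A A1 (a : arr A A1) (p : chain n.+1 A1 (S A)) :
  is_angle (existT _ A1 (a, p)) <-> is_angle (chain_rcons p (sgn *: smap S a)).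
Proof. exact: angle_rotate. Qed.

Lemma angle_transport A B (p : chain n.+2 A (S A)) (q : chain n.+2 B (S B)) f :
  is_iso f -> chain_iso p q f (smap S f) -> is_angle p -> is_angle q.
Proof.
move=> f_iso /(components_of_chain_iso f_iso) [phi [phi0 phi_iso phi_arr phi_last]].
apply: angle_iso; rewrite -phi0 in phi_last.
pose s := existT (fun X => chain n.+2 X (S X)) A p.
pose t := existT (fun X => chain n.+2 X (S X)) B q.
by exists (@SeqMor _ _ S n.+1 s t phi phi_arr phi_last).
Qed.

Lemma angle_morphism A A1 B B1 (a : arr A A1) (b : arr B B1)
    (p : chain n.+1 A1 (S A)) (q : chain n.+1 B1 (S B)) f0 f1 :
  is_angle (existT _ A1 (a, p)) -> is_angle (existT _ B1 (b, q)) ->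
  f1 ∘ a = b ∘ f0 -> chain_mor p q f1 (smap S f0).
Proof.
move=> ang_p ang_q sq; have [phi [phi0 phi1]] := angle_mor ang_p ang_q sq.
rewrite -phi0 -phi1.
apply: (@chain_mor_of_components _ _ n.+1 _ _ _ _ p q (fun i => phi i.+1)).
  by move=> i i_lt; apply: (mcomp_arr phi (i := i.+1)).
exact: (mcomp_last phi).
Qed.

Lemma angle_trivial_chain A : is_angle (existT _ A (idm A, zero_chain n.+1 A (S A))).
Proof.
have := angle_trivial T A; rewrite /is_angle /trivial_seq /mk_sigma_seq /=.
by rewrite mkchain_zero.
Qed.

(** Its rotation is isomorphic to the trivial angle on [B], the suspension of a
    zero object being zero. *)
Lemma angle_shifted_trivial B :
  is_angle (existT _ B (0 : arr zero_ob B,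
    existT _ B (idm B, zero_chain n B (S zero_ob)))).
Proof.
apply/angle_rot; rewrite smap0 scaler0 /=.
apply: (angle_transport (f := idm B)) (angle_trivial_chain B).
  exact: is_iso_id.
exists (idm B); split=> //; first exact: is_iso_id.
exact/zero_chain_iso/is_zero_sus/zero_obP.
Qed.

(** All three parts extend a square between first morphisms: from the trivial
    angle on [A], from the rotated trivial angle on [W] to the rotated angle,
    and to the angle 0 -> W = W -> 0 -> ... *)
Lemma angle_exact_first A A1 A2 (a : arr A A1) (b : arr A1 A2)
    (p : chain n A2 (S A)) :
  is_angle (existT _ A1 (a, existT _ A2 (b, p))) -> exact_pair a b.
Proof.
move=> ang; split.
- have sq : a ∘ idm A = a ∘ idm A by [].
  have := angle_morphism (angle_trivial_chain A) ang sq.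
  by case=> c [_ /= <- _]; rewrite compm0.
- move=> W u bu.
  have sq : 0 ∘ (0 : arr W zero_ob) = b ∘ u by rewrite bu comp0m.
  have := angle_morphism ((angle_rot _ _).1 (angle_trivial_chain W))
    ((angle_rot _ _).1 ang) sq.
  move=> /chain_mor_last [c cP]; have [v vE] := smap_surj c.
  exists v; apply: (@smap_inj _ _ S); rewrite smapM -vE.
  move: cP; rewrite smap1 compZl compZr compm1 => /(congr1 ( *:%R sgn)).
  by rewrite !sgn_cancel.
move=> W u ua.
have sq : u ∘ a = 0 ∘ (0 : arr A zero_ob) by rewrite ua comp0m.
have [c [_ /= cb _]] := angle_morphism ang (angle_shifted_trivial W) sq.
by exists c; rewrite cb comp1m.
Qed.

(** By rotation, from the first two morphisms. *)
Lemma angle_exact i A (p : chain n.+2 A (S A)) :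
  is_angle p -> (i < n.+2)%N -> exact_pair (chain_arr i p) (chain_arr i.+1 p).
Proof.
elim: i A p => [|i IH] A [A1 [a p]]; first by case: p => A2 [b p] /angle_exact_first.
move=> ang i_lt; have := IH _ _ ((angle_rot _ _).1 ang) (ltnW i_lt).
by move/(chain_pair_rcons (fun _ _ _ f g => exact_pair f g)
  (p : chain n.+1 A1 (S A)) _ i_lt).
Qed.

Lemma exact_pairZ A B D (f : arr A B) (g : arr B D) :
  exact_pair f (sgn *: g) -> exact_pair f g.
Proof.
move=> [gf ker coker]; split=> [|W u gu|W u uf].
- by rewrite -[LHS]sgn_cancel -compZl gf scaler0.
- by apply: ker; rewrite compZl gu scaler0.
by have [v ->] := coker W u uf; exists (sgn *: v); rewrite compZr compZl.
Qed.

Lemma angle_exact_last A X (p : chain n.+1 A X) (d : arr X (S A)) :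
  is_angle (chain_rcons p d) -> exact_pair (chain_last p) d.
Proof.
move/angle_exact => /(_ n.+1 (leqnn _)).
by move/(chain_pair_rcons_last (fun _ _ _ f g => exact_pair f g)).
Qed.

Lemma angle_exact_around A X (p : chain n.+1 A X) (d : arr X (S A)) :
  is_angle (chain_rcons p d) -> exact_pair d (smap S (chain_arr 0 p)).
Proof.
case: p => A1 [a p] ang; have /angle_exact := (angle_rot _ _).1 ang.
move=> /(_ n.+1 (leqnn _)).
move/(chain_pair_rcons_last (fun _ _ _ f g => exact_pair f g)).
move/(chain_last_rcons (fun _ f => exact_pair f (sgn *: smap S a))).
exact: exact_pairZ.
Qed.

(** Up to sign, [d] is the suspension of a morphism; rotate an angle starting
    with that one. *)
Lemma angle_with_last A X (d : arr X (S A)) :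
  exists p : chain n.+1 A X, is_angle (chain_rcons p d).
Proof.
have [X' XE] := sus_surj S X; subst X.
have [f fE] := smap_surj (sgn *: d).
have [p ang] := angle_first T f; exists p.
rewrite -(sgn_cancel d) fE; exact: ((angle_rot f p).1 ang).
Qed.

Lemma angulated_extends_exactly : extends_exactly C.
Proof.
move=> A B f; split.
  have [[A2 [b p]] ang] := angle_first T f.
  by exists A2, b; apply: (@angle_exact_first _ _ _ f b p ang).
have [B' BE] := sus_surj S B; subst B.
have [p ang] := angle_with_last f.
by exists _, (chain_last p); exact: angle_exact_last ang.
Qed.

(** * Minimal angles *)

(** The angle is isomorphic to the direct sum of two sequences, [q] closed by
    [d] and [t] closed by 0, because the suspension of the inclusion of [A]
    matches their last morphisms; so closure under direct summands applies. *)
Lemma angle_dsum_left A X (p q : chain n.+1 A X) (d : arr X (S A))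
    (t : chain n.+1 zero_ob zero_ob) :
  chain_iso p (chain_dsum q t) (inj1 A zero_ob) (inj1 X zero_ob) ->
  is_angle (chain_rcons p d) -> is_angle (chain_rcons q d).
Proof.
move=> pqt ang; pose e : arr zero_ob (S zero_ob) := 0.
pose s A' p' := existT (fun X => chain n.+2 X (S X)) A' p'.
have := @angle_summand _ _ _ T (s A (chain_rcons q d)) (s zero_ob (chain_rcons t e)).
case=> //; rewrite /dsum_seq /mk_sigma_seq /sarr /slast /sob /=.
move: (mkchain_dsum q t d e (smap S (inj1 _ _)) (smap S (inj2 _ _))) => /= ->.
apply: angle_transport ang; first exact: (inj1_zero_iso A (@zero_obP k C)).
apply: chain_iso_rcons pqt _; first exact: (inj1_zero_iso X (@zero_obP k C)).
by rewrite /e comp0m compm0 addr0 compAr compAr prj1_inj1 compm1.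
Qed.

(** An inner morphism outside the radical lets a summand Y = Y be split off, and
    this strictly lowers the number of local summands of the inner objects. *)
Lemma angle_minimal A X (d : arr X (S A)) : krull_schmidt C ->
  exists p : chain n.+1 A X, is_angle (chain_rcons p d) /\
    forall i, (0 < i < n.+1)%N -> in_radical (chain_arr i p).
Proof.
move=> KS; have [p ang] := angle_with_last d.
have [N] := chain_size_exists p (krull_schmidt_local_sum KS).
have [M] := ubnP N; elim: M => // M IH in N p ang *.
rewrite ltnS => leNM szp.
case: (pselect (forall i, (0 < i < n.+1)%N -> in_radical (chain_arr i p))).
  by move=> rad; exists p.
move=> /existsNP [i /not_implyP [i_in nr]].
have [|N' [q [t [ltN szq pqt]]]] := chain_reduce i_in nr _ szp.
  move=> i' i'_lt; have [] := angle_exact ang (ltnW i'_lt : (i' < n.+2)%N).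
  by move/(chain_pair_rcons (fun _ _ _ f g => g ∘ f = 0) p d i'_lt).
exact: IH (angle_dsum_left pqt ang) (leq_trans ltN leNM) szq.
Qed.

(** Exactness on both sides of [d] turns the two halves of
    [almost_split_connecting] into the two almost split properties. *)
Lemma AR_angle_exists A X (d : arr X (S A)) :
  krull_schmidt C -> almost_split_connecting d ->
  exists s, [/\ AR_angle (T := T) s, sob s 0 = A & sob s n.+2 = X].
Proof.
move=> KS [dr dl]; have [p [ang rad]] := angle_minimal d KS.
exists (existT (fun X => chain n.+2 X (S X)) A (chain_rcons p d)).
split; rewrite /sob //=; last exact: chain_ob_rcons_last.
split=> //; rewrite /sarr.
- apply/(chain_arr_rcons (fun _ _ f => left_almost_split f)) => //=.
  have [ad _ coker] := angle_exact_around ang.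
  split=> [|B u nu]; first by move/(smap_split_mono S); exact: ((dl _ _).1 ad).
  have [|c cE] := coker (S B) (smap S u).
    by apply/dl => /smap_split_mono.
  have [v vE] := smap_surj c; exists v.
  by apply: (@smap_inj _ _ S); rewrite smapM -vE.
- apply/(chain_arr_rcons_last (fun _ _ f => right_almost_split f)) => /=.
  have [da ker _] := angle_exact_last ang.
  split=> [|W u nu]; first exact/dr.
  by apply: ker; apply/dr.
move=> i i_in; apply/(chain_arr_rcons (fun _ _ f => in_radical f)); last exact: rad.
by case/andP: i_in => _ /ltnW.
Qed.

End Angles.

Theorem corollary3p15 (k : comPzRingType) (k_artinian : artinian k)
    (E : lmodType k) (E_envelope : injective_envelope_of_top E)
    (n : nat) (n_ge1 : (1 <= n)%N)
    (C : addCat k) (T : angulated C n)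
    (C_krull_schmidt : krull_schmidt C)
    (C_dualizing : dualizing_variety C E) :
  has_AR_angles T.
Proof.
case: n n_ge1 T => // n _ T X /(indecomposable_local_endo C_krull_schmidt) locX.
case: C_dualizing => _ _ dual_contra_fp dual_co_fp.
have ext := angulated_extends_exactly T.
have size := krull_schmidt_local_sum C_krull_schmidt.
split.
  have tgt : has_local_targets C.
    by move=> A B h; have [m] := size B; apply: nonzero_target.
  have pres := dualizing_simple_presented k_artinian E_envelope dual_co_fp locX.
  have [Z [d [_ dP]]] := almost_split_connecting_exists ext tgt pres.
  have [A ZE] := sus_surj (susp T) Z; subst Z.
  by have [s [AR _ sX]] := AR_angle_exists C_krull_schmidt dP; exists s.
have src : has_local_sources C.
  by move=> A B h; have [m] := size A; apply: nonzero_source.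
have pres := dualizing_cosimple_presented k_artinian E_envelope dual_contra_fp
  (local_endo_sus (susp T) locX).
have [Z [d [_ dP]]] := almost_split_connecting_exists_dual ext src pres.
by have [s [AR sX _]] := AR_angle_exists C_krull_schmidt dP; exists s.
Qed.
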